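(* Let $G$ be a balanced bipartite graph of order $2n$ and of minimum degree $\delta(G)\geq k\geq 1$, where $k$ is an integer. (1) If $n\geq (k+1)^2$ and $\rho(G)\geq\rho(B^k_n)$, then $G$ is Hamiltonian unless $G=B^k_n$. (2) If $n\geq (k+1)^2$ and $q(G)\geq q(B^k_n)$, then $G$ is Hamiltonian unless $G=B^k_n$. (3) If $n\geq 2k$ and $\rho(\widehat{G})\leq\rho(\widehat{B^k_n})$, then $G$ is Hamiltonian unless $G\in\mathcal{B}_n^k$, or $n=4$, $k=2$ and $G=\varGamma_1$ or $G=\varGamma_2$.
   Context: All graphs are finite and simple; equality of graphs and membership in classes of graphs are up to isomorphism. $\rho(G)$ is the largest eigenvalue of the adjacency matrix $A$ of $G$; $q(G)$ is the largest eigenvalue of $A+D$, with $D$ the diagonal degree matrix. A graph is Hamiltonian if it contains a cycle through all its vertices. A bipartite graph with partite sets $X,Y$ is balanced if $|X|=|Y|$. The quasi-complement $\widehat{G}$ of a bipartite graph $G$ with partite sets $X,Y$ is the graph on the same vertex set (bipartite with the same partite sets) in which, for $x\in X$, $y\in Y$, $xy\in E(\widehat{G})$ if and only if $xy\notin E(G)$. For $1\leq k\leq n/2$: $B_n^k$ is the graph obtained from $K_{n,n}$ by deleting all edges of one subgraph $K_{n-k,k}$ (with its part of size $n-k$ in one partite set and its part of size $k$ in the other). $\mathcal{B}_n^k$ is the set of balanced bipartite graphs of order $2n$ obtained from some bipartite graph $H$ with partite sets $X_0,Y_0$ of sizes $k$ and $n-k$, respectively, by adding $k$ additional vertices, each adjacent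 exactly to all vertices of $X_0$, and $n-k$ additional vertices, each adjacent exactly to all vertices of $Y_0$. ($B_n^k$ is the member with $H$ complete bipartite.) $\varGamma_1$ is the bipartite graph with partite sets $\{t_1,t_2,t_3,t_4\}$ and $\{b_1,b_2,b_3,b_4\}$ and edge set $\{t_ib_i,\ t_1b_i,\ t_ib_1 : i=2,3,4\}$. $\varGamma_2$ is $\varGamma_1$ with the additional edge $t_1b_1$. *)

(* Defs.v *)
From mathcomp Require Import all_boot all_order all_algebra.
From mathcomp Require Import classical_sets reals.

Set Implicit Arguments.
Unset Strict Implicit.
Unset Printing Implicit Defensive.

Import Order.TTheory GRing.Theory Num.Theory.
Local Open Scope ring_scope.

Record sgraph := SGraph {
  vert :> finType;
  edge : rel vert;
  edge_sym : symmetric edge;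
  edge_irr : irreflexive edge }.

Definition isomorphic (G H : sgraph) : Prop :=
  exists f : G -> H, bijective f /\ forall x y, edge (f x) (f y) = edge x y.

Definition degree (G : sgraph) (x : G) : nat := #|[set y | edge x y]|.

(* Degrees are smaller than #|G|, so the default value #|G| only matters for
   the graph without vertices. *)
Definition min_degree (G : sgraph) : nat :=
  \big[minn/#|G|]_(x : G) degree x.

Definition hamiltonian (G : sgraph) : Prop :=
  exists c : seq G,
    [/\ cycle (@edge G) c, uniq c, (2 < size c)%N & forall x, x \in c].

Section Spectra.
Variable R : realType.

(* For a symmetric real matrix of positive size the set of eigenvalues is
   finite and nonempty, so that its supremum is its maximum. *)
Definition largest_eigenvalue m (A : 'M[R]_m) : R :=
  sup [set a | eigenvalue A a]%classic.

Definition adj_mx (G : sgraph) : 'M[R]_#|G| :=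
  \matrix_(i, j) (edge (enum_val i) (enum_val j))%:R.

Definition deg_mx (G : sgraph) : 'M[R]_#|G| :=
  diag_mx (\row_i (degree (enum_val i))%:R).

Definition rho (G : sgraph) : R := largest_eigenvalue (adj_mx G).

Definition q (G : sgraph) : R := largest_eigenvalue (adj_mx G + deg_mx G).

End Spectra.

(* A bipartition is given by one partite set X, the other one being ~: X. *)
Definition bipartition (G : sgraph) (X : {set G}) : Prop :=
  forall x y : G, edge x y -> (x \in X) != (y \in X).

Definition balanced_bipartition (n : nat) (G : sgraph) (X : {set G}) : Prop :=
  [/\ bipartition X, #|X| = n & #|~: X| = n].

Section QuasiComplement.
Variables (G : sgraph) (X : {set G}).

Definition qcompl_edge : rel G :=
  fun x y => ((x \in X) != (y \in X)) && ~~ edge x y.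

Lemma qcompl_sym : symmetric qcompl_edge.
Proof. by move=> x y; rewrite /qcompl_edge eq_sym edge_sym. Qed.

Lemma qcompl_irr : irreflexive qcompl_edge.
Proof. by move=> x; rewrite /qcompl_edge eqxx. Qed.

(* When G is disconnected this depends on the chosen bipartition. *)
Definition quasi_complement : sgraph := SGraph qcompl_sym qcompl_irr.

End QuasiComplement.

Section Bigraph.
Variables (S T : finType) (r : S -> T -> bool).

Definition bigraph_edge : rel (S + T)%type := fun u v =>
  match u, v with
  | inl x, inr y => r x y
  | inr y, inl x => r x y
  | _, _ => false
  end.

Lemma bigraph_sym : symmetric bigraph_edge.
Proof. by case=> [x|y] [x'|y']. Qed.

Lemma bigraph_irr : irreflexive bigraph_edge.
Proof. by case. Qed.

Definition bigraph : sgraph := SGraph bigraph_sym bigraph_irr.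

Definition bigraph_left : {set bigraph} :=
  [set u : S + T | if u is inl _ then true else false].

End Bigraph.

(* The first n - k vertices of one partite set and the first k vertices of the
   other one span the deleted K_{n-k,k}. *)
Definition Bnk_rel (n k : nat) (x y : 'I_n) : bool :=
  ~~ ((x < n - k)%N && (y < k)%N).

Definition Bnk (n k : nat) : sgraph := bigraph (@Bnk_rel n k).

Definition Bnk_qcompl (n k : nat) : sgraph :=
  quasi_complement (bigraph_left (@Bnk_rel n k)).

Section Attach.
Variables (H : sgraph) (X0 : {set H}) (a b : nat).

(* a new vertices joined to all of X0, and b new vertices joined to all of
   ~: X0. *)
Definition attach_edge : rel (H + ('I_a + 'I_b))%type := fun u v =>
  match u, v with
  | inl x, inl y => edge x y
  | inl x, inr (inl _) => x \in X0
  | inr (inl _), inl x => x \in X0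
  | inl x, inr (inr _) => x \notin X0
  | inr (inr _), inl x => x \notin X0
  | inr _, inr _ => false
  end.

Lemma attach_sym : symmetric attach_edge.
Proof. by case=> [x|[i|j]] [x'|[i'|j']] //=; apply: edge_sym. Qed.

Lemma attach_irr : irreflexive attach_edge.
Proof. by case=> [x|[i|j]] //=; apply: edge_irr. Qed.

Definition attach : sgraph := SGraph attach_sym attach_irr.

End Attach.

Definition calB (n k : nat) (G : sgraph) : Prop :=
  exists (H : sgraph) (X0 : {set H}),
    [/\ bipartition X0, #|X0| = k, #|~: X0| = (n - k)%N
      & isomorphic G (attach X0 k (n - k))].

(* The vertex t_(i+1) is inl i and b_(j+1) is inr j. *)
Definition Gamma2_rel (i j : 'I_4) : bool :=
  [|| i == j, i == ord0 | j == ord0].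

Definition Gamma1_rel (i j : 'I_4) : bool :=
  Gamma2_rel i j && ~~ ((i == ord0) && (j == ord0)).

Definition Gamma1 : sgraph := bigraph Gamma1_rel.
Definition Gamma2 : sgraph := bigraph Gamma2_rel.

(* Main.v *)
(** If G is not Hamiltonian, enlarge it to an edge-maximal non-Hamiltonian
    bipartite graph e on the same partite sets. Non-adjacent x, y on different
    sides of e are then joined by a Hamiltonian path, so that d(x) + d(y) <= n.

    For (1) and (2), [rho^2 <= |E|] and [q <= |E|/n + n], while [B_n^k] properly
    contains [K_{n,n-k}], so its rho and q exceed [sqrt (n (n-k))] and [2n - k].
    Hence |E| > n (n-k), and counting the edges around a non-adjacent pair of
    maximal degree sum shows that e is [B_n^k]. A connected graph has a strictly
    larger rho and q than its proper spanning subgraphs, so G = e.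

    For (3), let d' be the degree in the quasi-complement e' of e. Every edge uv
    of e' has d'(u) d'(v) >= k (n-k), so the test vector sqrt d' gives
    [rho >= sqrt (k (n-k))] for the quasi-complement of G, and the hypothesis
    forces equality throughout: d(x) + d(y) = n for all pairs not adjacent in e,
    and G agrees with e at every vertex not isolated in e'. Along a Hamiltonian
    path from x to y, this degree condition leaves two cases: the neighbours
    of x form an initial segment, and e' has a component [K_{k,n-k}]; or there is
    a cycle missing just two adjacent vertices, and e is [Gamma2]. *)

Require Import Defs.
From mathcomp Require Import all_boot all_order all_algebra.
From mathcomp Require Import zify ring lra.

Set Implicit Arguments.
Unset Strict Implicit.
Unset Printing Implicit Defensive.

Import Order.TTheory GRing.Theory Num.Theory.

(** * Hamiltonian cycles in bipartite graphs *)

(** The edge threshold behind (1) and (2) is n(n-k-1) + (k+1)^2, the number of edges of B_n^{k+1}.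
    Since n >= (k+1)^2, it is at most n(n-k), the number of edges that the spectral bounds
    guarantee.

    For (3), d' = n - d, so d(u), d(v) >= k and d(u) + d(v) <= n give d'(u)d'(v) >= k(n-k). The
    obstacle is that quasi-complements are usually disconnected, so no positive Perron vector is
    available and strict monotonicity of the spectral radius fails. What survives is the equality
    case of the Rayleigh bound: sqrt d' is a maximizer for the quasi-complement of G, hence an
    eigenvector, and it is positive exactly at the vertices not isolated in e'. Nothing is thereby
    forced between two vertices isolated in e', which is the source of the arbitrary H in the class
    [calB] and of [Gamma1] beside [Gamma2]. *)

Section CycleSurgery.
Variables (V : eqType) (e : rel V) (x0 : V).
Hypothesis eC : symmetric e.
Implicit Types (a b : V) (A B C : seq V).

Lemma sorted_catE A B : A != [::] -> B != [::] ->
  sorted e (A ++ B) = [&& sorted e A, sorted e B & e (last x0 A) (head x0 B)].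
Proof.
case: A => // a A; case: B => // b B _ _ /=.
by rewrite cat_path /= [in RHS]andbA [RHS]andbC andbCA andbA.
Qed.

Lemma cycle_sortedE A : A != [::] -> cycle e A = sorted e A && e (last x0 A) (head x0 A).
Proof. by case: A => // a A _; rewrite /= rcons_path. Qed.

Lemma sorted_revE A : sorted e (rev A) = sorted e A.
Proof. by rewrite rev_sorted; apply: eq_sorted => a b; exact: eC. Qed.

Lemma head_rev A : head x0 (rev A) = last x0 A.
Proof. by case/lastP: A => // A a; rewrite rev_rcons last_rcons. Qed.

Lemma last_rev A : last x0 (rev A) = head x0 A.
Proof. by rewrite -head_rev revK. Qed.

Lemma rev_neq0 A : A != [::] -> rev A != [::].
Proof. by rewrite -!size_eq0 size_rev. Qed.

(** The rotation behind Ore's argument: run A backwards from its last vertex, jump from the head of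
    A to the head of B, and close at the two last vertices. *)
Lemma cycle_flip_prefix A B : A != [::] -> B != [::] ->
  sorted e A -> sorted e B -> e (head x0 A) (head x0 B) -> e (last x0 A) (last x0 B) ->
  cycle e (rev A ++ B).
Proof.
move=> A0 B0 sA sB hh ll.
rewrite cycle_sortedE; last by case: (rev A) (rev_neq0 A0).
rewrite sorted_catE ?rev_neq0 // sorted_revE sA sB last_rev hh /=.
have -> : head x0 (rev A ++ B) = last x0 A.
  by rewrite -head_rev; case: (rev A) (rev_neq0 A0).
by rewrite last_cat eC; case: (B) B0 ll => // b B' _ /=.
Qed.

(** The cycle runs A backwards, B forwards and C backwards, so it keeps every edge of the path
    except the two that join A to B and B to C. *)
Lemma cycle_flip_ends A B C : A != [::] -> B != [::] -> C != [::] ->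
  sorted e (A ++ B ++ C) -> e (head x0 A) (head x0 B) -> e (last x0 B) (last x0 C) ->
  e (last x0 A) (head x0 C) -> cycle e (rev A ++ B ++ rev C).
Proof.
move=> A0 B0 C0; have BC0 : B ++ C != [::] by case: (B) B0.
rewrite !sorted_catE // => /and3P[sA /and3P[sB sC _] _] hh ll lh.
have C0' := rev_neq0 C0; have BC0' : B ++ rev C != [::] by case: (B) B0.
apply: cycle_flip_prefix => //.
- by rewrite sorted_catE // sB sorted_revE sC head_rev ll.
- by case: (B) B0 hh.
- by rewrite last_cat; case: (rev C) C0' (last_rev C) => // c C' _ /= ->.
Qed.

Lemma head_drop (A : seq V) i : head x0 (drop i A) = nth x0 A i.
Proof. by rewrite -nth0 nth_drop addn0. Qed.

Lemma last_take (A : seq V) i : (i < size A)%N -> last x0 (take i.+1 A) = nth x0 A i.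
Proof. by move=> lt; rewrite (last_nth x0) size_takel //= nth_take. Qed.

End CycleSurgery.

Section CycleInsertion.
Variables (V : eqType) (e : rel V).
Hypothesis eC : symmetric e.
Implicit Types (a b q u w : V) (A B : seq V).

Lemma rot_to_prev A q : uniq A -> q \in A ->
  exists i s, rot i A = q :: s /\ last q s = prev A q.
Proof.
move=> uA qA; have [i s rE] := rot_to qA; exists i, s; split=> //.
have uqs : uniq (q :: s) by rewrite -rE rot_uniq.
rewrite -(prev_rot i uA) rE prev_nth mem_head.
by move: uqs => /= /andP[/memNindex -> _]; rewrite -last_nth.
Qed.

Lemma cycle_insert A a b q : uniq A -> cycle e A -> q \in A ->
  e (prev A q) a -> e a b -> e b q ->
  exists2 B, cycle e B & perm_eq B (a :: b :: A).
Proof.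
move=> uA cA qA pa ab bq; have [i [s [rE ls]]] := rot_to_prev uA qA.
have := cA; rewrite -(rot_cycle i) rE /= rcons_path => /andP[ps _].
exists (a :: b :: q :: s); last by rewrite !perm_cons -rE perm_rot.
by rewrite /= ab bq rcons_path ps ls.
Qed.

(** Cut the cycle before [u] and before [w]. The new cycle runs from [prev A w] back to [u], crosses
    the chord to [w], runs forward to [prev A u], and returns through [a] and [b]. *)
Lemma cycle_insert_chord A a b u w : uniq A -> cycle e A -> u \in A -> w \in A ->
  u != w -> e u w -> e a b -> e (prev A u) a -> e (prev A w) b ->
  exists2 B, cycle e B & perm_eq B (a :: b :: A).
Proof.
move=> uA cA uinA winA nuw uw ab ua wb; have [i [s [rE ls]]] := rot_to_prev uA uinA.
have := cA; rewrite -(rot_cycle i) rE /= rcons_path => /andP[ps _].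
have : w \in u :: s by rewrite -rE mem_rot.
rewrite inE eq_sym (negbTE nuw) /= => ws.
have uus : uniq (u :: s) by rewrite -rE rot_uniq.
have pw : prev A w = prev (u :: s) w by rewrite -rE prev_rot.
case/splitPr: ws rE ls ps uus pw => s1 s2 rE ls ps uus pw.
have {}pw : prev A w = last u s1.
  rewrite pw prev_nth !inE mem_cat mem_head !orbT.
  have ws1 : w \notin s1.
    by move: uus; rewrite /= cat_uniq /= => /and4P[_ _ /norP[]].
  by rewrite index_cat (negbTE ws1) /= eqxx addn0 -cat_cons nth_cat /= ltnSn -last_nth.
exists (rev (u :: s1) ++ (w :: s2 ++ [:: a; b])); last first.
  have /permP pA : perm_eq (u :: s1 ++ w :: s2) A by rewrite -rE perm_rot.
  apply/permP => P; rewrite /= -pA /= !count_cat count_rev /= count_cat /=; clear; lia.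
move: ps; rewrite cat_path /= => /and3P[ps1 _ ps2].
have lE : last u (s1 ++ w :: s2) = last w s2 by rewrite last_cat.
apply: (cycle_flip_prefix (x0 := u)) => //=.
  by rewrite cat_path ps2 /= ab -lE ls ua.
by rewrite last_cat /= -pw.
Qed.

End CycleInsertion.

(** * Edge-maximal non-Hamiltonian graphs and their Hamiltonian paths *)

Section HamiltonianCycles.
Variable V : finType.
Implicit Types (e : rel V) (X : {set V}).

(** A boolean, so that [maxset_exists] applies. A single edge walked back and forth is not excluded
    here; [hamcyc_hamiltonian] restores the length condition from [2 < #|G|]. *)
Definition hamcyc e : bool := [exists c : #|V|.-tuple V, cycle e c && uniq c].

Lemma hamcycP e :
  reflect (exists c, [/\ cycle e c, uniq c & size c = #|V|]) (hamcyc e).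
Proof.
apply: (iffP existsP) => [[c /andP[cc uc]]|[c [cc uc sc]]].
  by exists c; rewrite size_tuple.
by exists (tcast sc (in_tuple c)); rewrite val_tcast cc.
Qed.

Lemma perm_hamcyc e B c : cycle e B -> perm_eq B c -> uniq c -> size c = #|V| -> hamcyc e.
Proof.
by move=> cB pB uc sc; apply/hamcycP; exists B; rewrite (perm_uniq pB) (perm_size pB).
Qed.

Definition bipartite_rel X e := forall x y, e x y -> (x \in X) != (y \in X).

Definition ham_path e x y :=
  exists p, [/\ path e x p, last x p = y, uniq (x :: p) & (size p).+1 = #|V|].

(* The consequence of edge-maximality that is actually needed. *)
Definition ham_saturated X e :=
  [/\ symmetric e, bipartite_rel X e, ~~ hamcyc e &
    forall x y, x \in X -> y \notin X -> ~~ e x y -> ham_path e x y].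

Lemma ham_path_sym e x y : symmetric e -> ham_path e x y -> ham_path e y x.
Proof.
move=> eC [p [pp lp up sp]]; exists (behead (rev (x :: p))).
have rE : y :: behead (rev (x :: p)) = rev (x :: p).
  by rewrite -lp; case/lastP: (p) => // p' z; rewrite -rcons_cons rev_rcons last_rcons.
split.
- by rewrite -[path _ _ _]/(sorted e (y :: _)) rE sorted_revE.
- by rewrite -[last y _]/(last x (y :: _)) rE last_rev.
- by rewrite rE rev_uniq.
- by rewrite size_behead size_rev.
Qed.

Lemma ham_saturatedC X e : ham_saturated X e -> ham_saturated (~: X) e.
Proof.
move=> [eC bX nh hp]; split=> // [x y /bX|x y]; first by rewrite !inE (inj_eq negb_inj).
rewrite !inE negbK => xX yX nxy; apply: ham_path_sym => //; apply: hp => //.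
by rewrite eC.
Qed.

(** A Hamiltonian cycle of the enlarged graph must use the new edge; rotated, and reversed if
    necessary, it starts at [x] and ends at [y]. With at least three vertices the successor of [x]
    is not [y], so the remaining edges are all old. *)
Lemma hamcyc_add_edge e x y : (2 < #|V|)%N -> symmetric e -> x != y -> ~~ hamcyc e ->
  hamcyc (fun u v => [|| e u v, (u == x) && (v == y) | (u == y) && (v == x)]) ->
  ham_path e x y.
Proof.
set e' := fun u v => _ => V2 eC nxy nh /hamcycP[c [cc uc sc]].
have e'C : symmetric e'.
  by move=> u v; rewrite /e' eC [(u == x) && _]andbC [(u == y) && _]andbC [X in _ || X]orbC.
have prev_case c' : cycle e' c' -> uniq c' -> size c' = #|V| -> x \in c' ->
    prev c' x = y -> ham_path e x y.
  move=> cc' uc' sc' xc' px; have [i [p [rE lp]]] := rot_to_prev uc' xc'.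
  have cp : cycle e' (x :: p) by rewrite -rE rot_cycle.
  have up : uniq (x :: p) by rewrite -rE rot_uniq.
  have sp : (size p).+1 = #|V| by rewrite -sc' -(size_rot i c') rE.
  exists p; split=> //; last by rewrite lp.
  case: p lp cp up sp {rE} => [|z p] lp cp up sp; first by rewrite -sp in V2.
  move: cp up; rewrite /= inE negb_or rcons_path.
  move=> /and3P[xz zp _] /and3P[/andP[nxz xp] zNp up].
  have nzy : z != y.
    apply: contra zNp => /eqP zy; rewrite zy -px -lp /=.
    by case: (p) sp => [sp|w p' _]; [rewrite -sp in V2|exact: mem_last w p'].
  have xze : e x z.
    by move: xz; rewrite /e' eqxx (negbTE nzy) (eq_sym z) (negbTE nxz) /= andbF orbF.
  rewrite xze /=.
  apply: (@sub_in_path _ (predC1 x) e') zp.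
    by move=> u v; rewrite !inE => /negbTE ux /negbTE vx /or3P[//||]; rewrite ?ux ?vx ?andbF.
  by rewrite /= eq_sym nxz; apply/allP => w wp /=; apply: contraNneq xp => <-.
have allc v : v \in c.
  have /subset_cardP/(_ (subset_predT _)) -> // : #|c| = #|V| by rewrite -sc; exact/card_uniqP.
have [v /andP[vc nv]|all_e] := pickP (fun v => (v \in c) && ~~ e v (next c v)); last first.
  case/negP: nh; apply/hamcycP; exists c; split=> //; apply: cycle_from_next => // v vc.
  by have := all_e v; rewrite /= vc /= => /negbFE.
have := next_cycle cc vc; rewrite /e' (negbTE nv) /= => /orP[]/andP[/eqP vE /eqP nE].
  apply: (prev_case (rev c)); rewrite ?rev_uniq ?size_rev ?mem_rev //.
    by rewrite rev_cycle (eq_cycle (e' := e')) // => u w; exact: e'C.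
  by rewrite prev_rev // -vE.
by apply: (prev_case c) => //; rewrite -nE prev_next.
Qed.

Lemma exists_ham_saturated X e : (2 < #|V|)%N -> symmetric e -> bipartite_rel X e ->
  ~~ hamcyc e -> exists2 e', ham_saturated X e' & subrel e e'.
Proof.
move=> V2 eC bX nh.
pose rel_of (E : {set V * V}) : rel V := fun x y => (x, y) \in E.
pose good (E : {set V * V}) := [&& [forall x, forall y, rel_of E x y ==> rel_of E y x],
  [forall x, forall y, rel_of E x y ==> ((x \in X) != (y \in X))] & ~~ hamcyc (rel_of E)].
pose E0 := [set u : V * V | e u.1 u.2].
have E0E : rel_of E0 =2 e by move=> x y; rewrite /rel_of inE.
have hamE e1 e2 : e1 =2 e2 -> hamcyc e1 = hamcyc e2.
  by move=> e12; apply: eq_existsb => c; rewrite (eq_cycle e12).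
have gE0 : good E0.
  apply/and3P; split; last by rewrite (hamE _ _ E0E).
    by apply/'forall_forallP => x y; rewrite !E0E eC implybb.
  by apply/'forall_forallP => x y; rewrite !E0E; apply/implyP; exact: bX.
have [E /maxsetP[/and3P[/'forall_forallP sE /'forall_forallP bE hE] maxE] /subsetP E0sub]
  := maxset_exists gE0.
have EC : symmetric (rel_of E).
  by move=> x y; apply/idP/idP; apply/implyP; exact: sE.
have bE' : bipartite_rel X (rel_of E) by move=> x y; exact/implyP.
exists (rel_of E); last by move=> x y xy; apply: E0sub; rewrite inE.
split=> // x y xX yX nxy.
have nexy : x != y by apply: contraNneq yX => <-.
apply: hamcyc_add_edge => //; apply: contraR nxy => nh'.
pose E1 := (x, y) |: ((y, x) |: E).
have E1E : rel_of E1 =2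
    (fun u v => [|| rel_of E u v, (u == x) && (v == y) | (u == y) && (v == x)]).
  by move=> u v; rewrite /rel_of !inE !xpair_eqE orbA orbC.
have gE1 : good E1.
  apply/and3P; split; last by rewrite (hamE _ _ E1E).
    apply/'forall_forallP => u v; rewrite !E1E EC; apply/implyP.
    by case/or3P => [->//||] /andP[-> ->]; rewrite !orbT.
  apply/'forall_forallP => u v; rewrite E1E; apply/implyP.
  by case/or3P => [/bE'//||] /andP[/eqP-> /eqP->]; rewrite xX (negbTE yX).
rewrite -(maxE _ gE1) /rel_of ?inE ?eqxx //.
by apply/subsetP => u uE; rewrite !inE uE !orbT.
Qed.

End HamiltonianCycles.

Section HamPathIndices.
Variables (V : finType) (X : {set V}) (e : rel V) (n : nat).
Hypotheses (eC : symmetric e) (bX : bipartite_rel X e) (nh : ~~ hamcyc e).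
Hypotheses (cX : #|X| = n) (cXC : #|~: X| = n).
Variables (x y : V) (p : seq V).
Hypotheses (xX : x \in X) (pp : path e x p) (lp : last x p = y).
Hypotheses (up : uniq (x :: p)) (sp : (size p).+1 = #|V|).

Let c := x :: p.
(** The path alternates sides: even positions lie in X, odd ones outside. It reads [xs 0], [ys 0],
    [xs 1], ... from [x] to [y], which is [ys n.-1]; the default [x] of [nth] is never reached for
    indices below [n]. *)
Definition xs i := nth x c i.*2.
Definition ys i := nth x c i.*2.+1.

Lemma card_balanced : #|V| = n.*2.
Proof. by rewrite -(cardsC X) cX cXC addnn. Qed.

Let size_c : size c = n.*2.
Proof. by rewrite /= sp card_balanced. Qed.

Lemma mem_ham_path v : v \in c.
Proof.
have /subset_cardP/(_ (subset_predT _)) -> // : #|c| = #|V|.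
by rewrite -sp; exact/card_uniqP.
Qed.

Lemma nth_ham_path_color i : (i < n.*2)%N -> (nth x c i \in X) = ~~ odd i.
Proof.
elim: i => [|i IH] lti /=; first by rewrite xX.
have /(pathP x)/(_ i) := pp; rewrite -ltnS -[(size p).+1]/(size c) size_c => /(_ lti).
by move/bX; rewrite -/c IH 1?ltnW //= => h; move: h; case: (odd i); case: (nth x p i \in X).
Qed.

Lemma xs_X i : (i < n)%N -> xs i \in X.
Proof. by move=> lti; rewrite nth_ham_path_color ?odd_double ?ltn_double. Qed.

Lemma ys_X i : (i < n)%N -> ys i \notin X.
Proof. by move=> lti; rewrite nth_ham_path_color /= ?odd_double //; lia. Qed.

Lemma xs_inj : {in gtn n &, injective xs}.
Proof.
move=> i j; rewrite !inE => li lj /eqP.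
rewrite nth_uniq ?size_c ?ltn_double // => /eqP; exact: double_inj.
Qed.

Lemma ys_inj : {in gtn n &, injective ys}.
Proof.
move=> i j; rewrite !inE => li lj /eqP.
by rewrite nth_uniq ?size_c //; lia.
Qed.

Lemma xs_surj v : v \in X -> exists i : 'I_n, v = xs i.
Proof.
move=> vX; have vc := mem_ham_path v.
have lti : (index v c < n.*2)%N by rewrite -size_c index_mem.
have := nth_ham_path_color lti; rewrite nth_index // vX => /esym/negbTE od.
have ltj : ((index v c)./2 < n)%N by lia.
by exists (Ordinal ltj); rewrite /xs -[in LHS](nth_index x vc); congr nth => /=; lia.
Qed.

Lemma ys_surj v : v \notin X -> exists i : 'I_n, v = ys i.
Proof.
move=> vX; have vc := mem_ham_path v.
have lti : (index v c < n.*2)%N by rewrite -size_c index_mem.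
have := nth_ham_path_color lti; rewrite nth_index // (negbTE vX) => /esym/negbFE od.
have ltj : ((index v c)./2 < n)%N by lia.
by exists (Ordinal ltj); rewrite /ys -[in LHS](nth_index x vc); congr nth => /=; lia.
Qed.

Lemma card_xs (P : pred V) : #|[set v in X | P v]| = #|[set i : 'I_n | P (xs i)]|.
Proof.
rewrite -(card_in_imset (f := fun i : 'I_n => xs i) (D := mem [set i : 'I_n | P (xs i)])).
  congr #|pred_of_set _|; apply/setP => v; rewrite !inE; apply/andP/imsetP.
    by case=> /xs_surj[i ->] Pi; exists i => //; rewrite inE.
  by case=> i; rewrite inE => Pi ->; rewrite xs_X.
by move=> i j _ _ /xs_inj/val_inj; rewrite !inE; apply.
Qed.

Lemma card_ys (P : pred V) : #|[set v | (v \notin X) && P v]| = #|[set i : 'I_n | P (ys i)]|.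
Proof.
rewrite -(card_in_imset (f := fun i : 'I_n => ys i) (D := mem [set i : 'I_n | P (ys i)])).
  congr #|pred_of_set _|; apply/setP => v; rewrite !inE; apply/andP/imsetP.
    by case=> /ys_surj[i ->] Pi; exists i => //; rewrite inE.
  by case=> i; rewrite inE => Pi ->; rewrite ys_X.
by move=> i j _ _ /ys_inj/val_inj; rewrite !inE; apply.
Qed.

Lemma n_gt0 : (0 < n)%N.
Proof. by rewrite -cX; apply/card_gt0P; exists x. Qed.

Lemma ys_last : ys n.-1 = y.
Proof.
have n0 := n_gt0; rewrite /ys -lp (last_nth x); congr nth.
by have := size_c; rewrite /=; lia.
Qed.

Lemma e_x_ys0 : e x (ys 0).
Proof.
have n0 := n_gt0; have := size_c; rewrite /ys /=.
by case: p pp => [|z q] /=; [lia|case/andP].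
Qed.

Lemma e_xs_ys i : (i < n)%N -> e (xs i) (ys i).
Proof.
move=> lti; have /(pathP x)/(_ i.*2) := pp; apply.
by have := size_c; rewrite /=; lia.
Qed.

Lemma e_ys_xs i : (i.+1 < n)%N -> e (ys i) (xs i.+1).
Proof.
move=> lti; have /(pathP x)/(_ i.*2.+1) := pp; apply.
by have := size_c; rewrite /=; lia.
Qed.

Let sorted_c : sorted e c. Proof. by []. Qed.

Let size_neq0 (A : seq V) : (0 < size A)%N -> A != [::].
Proof. by case: A. Qed.

Let not_cycle B : cycle e B -> perm_eq B c -> False.
Proof.
move=> cB pB; case/negP: nh; apply: (perm_hamcyc cB pB) => //.
Qed.

(** With both edges present, reversing the path up to [xs i] would close it into a Hamiltonian
    cycle. *)
Lemma ham_path_no_crossing i : (i < n)%N -> e x (ys i) -> ~~ e (xs i) y.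
Proof.
move=> lti xy; apply/negP => xiy.
pose A := take i.*2.+1 c; pose B := drop i.*2.+1 c.
have cAB : A ++ B = c by exact: cat_take_drop.
have A0 : A != [::] by apply: size_neq0; rewrite size_take size_c; case: ifP; lia.
have B0 : B != [::] by apply: size_neq0; rewrite size_drop size_c; lia.
apply: (not_cycle (B := rev A ++ B)); last by rewrite -cAB perm_cat ?perm_rev // perm_sym perm_rev.
have [sA sB] : sorted e A /\ sorted e B by split; [exact: take_sorted|exact: drop_sorted].
apply: (cycle_flip_prefix (x0 := x)) => //.
  by rewrite head_drop -/(ys i).
rewrite last_take ?size_c ?ltn_double // -/(xs i).
have -> // : last x B = y.
by rewrite -lp -[last x p]/(last x c) -cAB last_cat; case: (B) B0.
Qed.

(** Cut the path after [xs i] and after [xs j]. The edges from [x] to [ys i], from [xs j] to [y] and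
    from [xs i] to [ys j] would be exactly those that [cycle_flip_ends] needs. *)
Lemma ham_path_no_double_crossing i j : (i < j)%N -> (j < n)%N ->
  e x (ys i) -> e (xs j) y -> ~~ e (xs i) (ys j).
Proof.
move=> ij jn xyi xjy; apply/negP => xiyj.
pose A := take i.*2.+1 c; pose D := drop i.*2.+1 c.
pose B := take (j - i).*2 D; pose C := drop (j - i).*2 D.
have cAD : A ++ D = c by exact: cat_take_drop.
have DBC : B ++ C = D by exact: cat_take_drop.
have sD : size D = (n.*2 - i.*2.+1)%N by rewrite size_drop size_c.
have A0 : A != [::] by apply: size_neq0; rewrite size_take size_c; case: ifP;
    move: ij jn; clear; lia.
have B0 : B != [::] by apply: size_neq0; rewrite size_take sD; case: ifP; move: ij jn; clear; lia.
have C0 : C != [::] by apply: size_neq0; rewrite size_drop sD; move: ij jn; clear; lia.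
apply: (not_cycle (B := rev A ++ B ++ rev C)); last first.
  by rewrite -cAD -DBC; apply/permP => P; rewrite !count_cat !count_rev.
apply: (cycle_flip_ends (x0 := x)) => //.
- by rewrite DBC cAD.
- have -> : head x B = head x D by rewrite -DBC; case: (B) B0.
  by rewrite head_drop -/(ys i).
- have -> : last x B = xs j.
    rewrite /B -[(j - i).*2]prednK ?double_gt0 ?subn_gt0 // last_take ?sD; last first.
      by move: ij jn; clear; lia.
    by rewrite nth_drop; congr nth; move: ij jn; clear; lia.
  have -> // : last x C = y.
  rewrite -lp -[last x p]/(last x c) -cAD -DBC !last_cat.
  by case: (C) C0.
- rewrite last_take ?size_c ?ltn_double; last by move: ij jn; clear; lia.
  rewrite head_drop nth_drop -/(xs i).
  have -> // : nth x c (i.*2.+1 + (j - i).*2) = ys j by congr nth; move: ij jn; clear; lia.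
Qed.

End HamPathIndices.

(** * Non-Hamiltonian graphs with many edges *)

Lemma edge_count_large k s n a E : (k < s <= a)%N -> (a <= n)%N -> (2 * s <= n)%N ->
  (n * (n - k - 1) + (k + 1) ^ 2 < E)%N -> ~~ (E <= a * s + (n - a) * n)%N.
Proof.
(* The excluded right-hand side bounds the edges when [a] vertices of one side have degree at most
   [s]. It does not increase with [a], nor, at a = s, with s up to n/2; its value at a = s = k+1 is
   the threshold. *)
move=> /andP[ks sa] an sn; rewrite -ltnNge -mulnn => He; apply: leq_trans He.
have [t tE] : exists t, s = (k.+1 + t)%N by exists (s - k.+1)%N; lia.
have [m nE] : exists m, n = (s + k.+1 + m)%N by exists (n - (s + k.+1))%N; lia.
have [a' aE] : exists a', a = (s + a')%N by exists (a - s)%N; lia.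
have [b bE] : exists b, n = (a + b)%N by exists (n - a)%N; lia.
have -> : (n - a = b)%N by lia.
have -> : (n - k - 1 = s + m)%N by lia.
have P1 : (a' * s <= a' * n)%N by rewrite leq_mul2l; lia.
have P2 : (0 <= t * m)%N by [].
have P3 : (a * s + b * n = s * s + a' * s + b * n)%N by rewrite aE mulnDl.
have P4 : (s * n + a' * n + b * n = n * n)%N by rewrite -!mulnDl -aE -bE.
subst s n; clear -P1 P2 P3 P4; lia.
Qed.

(** The case of [a] vertices of degree at most [k]: already a = k+1 of them leave the count k+1
    short of the threshold. *)
Lemma edge_count_wide k n a E : (k < a <= n)%N ->
  (n * (n - k - 1) + (k + 1) ^ 2 < E)%N -> ~~ (E <= a * k + (n - a) * n)%N.
Proof.
move=> /andP[ka an]; rewrite -ltnNge -mulnn => He; apply: leq_trans He.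
have [a' aE] : exists a', a = (k.+1 + a')%N by exists (a - k.+1)%N; lia.
have [b bE] : exists b, n = (a + b)%N by exists (n - a)%N; lia.
have -> : (n - a = b)%N by lia.
have -> : (n - k - 1 = a' + b)%N by lia.
have P1 : (a' * k <= a' * n)%N by rewrite leq_mul2l; lia.
by rewrite aE mulnDl; lia.
Qed.

(** The total k^2 + n + (n-k-1)(n-1) equals n(n-k-1) + k^2 + k + 1. In use, [k * k] bounds the
    degrees of the [k] vertices of low degree, [du] is the degree of one further vertex, and [F]
    collects the others on that side. *)
Lemma edge_count_missing k n du dv F E : (0 < k < n)%N -> (du + dv <= n)%N ->
  (n * (n - k - 1) + (k + 1) ^ 2 < E)%N -> (F <= (n - k - 1) * (n - 1) + dv)%N ->
  ~~ (E <= k * k + (du + F))%N.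
Proof.
move=> /andP[k0 kn] duv; rewrite -ltnNge -mulnn => He F1; apply: leq_trans He.
have [m nE] : exists m, n = (k + 1 + m)%N by exists (n - (k + 1))%N; lia.
move: F1; have -> : (n - k - 1 = m)%N by lia.
have -> : (n - 1 = k + m)%N by lia.
by rewrite nE in duv *; lia.
Qed.

Section Degrees.
Variable V : finType.
Implicit Types (e : rel V) (X S T : {set V}).

Definition deg e x := #|[set y | e x y]|.

Lemma degE e x : deg e x = (\sum_y e x y)%N.
Proof. by rewrite /deg -sum1dep_card big_mkcond. Qed.

Lemma bipartite_relC X e : bipartite_rel X e -> bipartite_rel (~: X) e.
Proof. by move=> bX x y /bX; rewrite !inE (inj_eq negb_inj). Qed.

Lemma deg_bipartite X e x : bipartite_rel X e -> x \in X ->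
  deg e x = #|[set y | (y \notin X) && e x y]|.
Proof.
move=> bX xX; apply: eq_card => y; rewrite !inE; case exy: (e x y); rewrite ?andbF //.
by have := bX _ _ exy; rewrite xX; case: (y \in X).
Qed.

Lemma deg_bipartiteC X e y : bipartite_rel X e -> symmetric e -> y \notin X ->
  deg e y = #|[set x in X | e x y]|.
Proof.
move=> bX eC yX; rewrite (deg_bipartite (bipartite_relC bX)) ?inE //.
by apply: eq_card => x; rewrite !inE negbK eC.
Qed.

Lemma sum_deg_bipartite X e : symmetric e -> bipartite_rel X e ->
  (\sum_(x in X) deg e x = \sum_(x in ~: X) deg e x)%N.
Proof.
move=> eC bX.
have E (Z : {set V}) : bipartite_rel Z e ->
    (\sum_(x in Z) deg e x = \sum_(x in Z) \sum_(y in ~: Z) e x y)%N.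
  move=> bZ; apply: eq_bigr => x xZ; rewrite degE [RHS]big_mkcond /=.
  apply: eq_bigr => y _; rewrite inE; case: ifPn => // /negbNE yZ.
  by case exy : (e x y) => //; have := bZ _ _ exy; rewrite xZ yZ.
rewrite E // E; last exact: bipartite_relC.
rewrite setCK exchange_big; apply: eq_bigr => x _; apply: eq_bigr => y _.
by rewrite eC.
Qed.

(** By [ham_path_no_crossing], the indices [i] with [ys i] adjacent to [x] and those with [xs i]
    adjacent to [y] form disjoint subsets of ['I_n]. *)
Lemma deg_sum_le X e n x y : ham_saturated X e -> #|X| = n -> #|~: X| = n ->
  x \in X -> y \notin X -> ~~ e x y -> (deg e x + deg e y <= n)%N.
Proof.
move=> [eC bX nh hp] cX cXC xX yX nxy.
have [p [pp lp up sp]] := hp _ _ xX yX nxy.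
rewrite (deg_bipartite bX xX) (deg_bipartiteC bX eC yX).
rewrite (card_ys bX nh cX cXC xX pp up sp (e x)) (card_xs bX nh cX cXC xX pp up sp (e^~ y)).
rewrite -cardsUI; set I := [set i | _]; set J := [set i | _].
have -> : I :&: J = set0.
  apply/setP => i; rewrite !inE; apply/negP => /andP[xi]; apply/negP.
  exact: (ham_path_no_crossing eC nh cX cXC xX pp lp up sp).
by rewrite cards0 addn0 (leq_trans (max_card _)) ?card_ord.
Qed.

Lemma deg_le_balanced X e n x : bipartite_rel X e -> #|X| = n -> #|~: X| = n ->
  (deg e x <= n)%N.
Proof.
move=> bX cX cXC.
have [xX|xX] := boolP (x \in X).
  rewrite (deg_bipartite bX xX) -cXC; apply: subset_leq_card.
  by apply/subsetP => y; rewrite !inE => /andP[].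
rewrite (deg_bipartite (bipartite_relC bX)) ?inE // -cX; apply: subset_leq_card.
by apply/subsetP => y; rewrite !inE negbK => /andP[].
Qed.

Definition block_complement X e S T :=
  [/\ S \subset X, T \subset ~: X &
    forall x y, x \in X -> y \notin X -> e x y = ~~ ((x \in S) && (y \in T))].

(* The non-neighbours of y number at least d(x) and have degree at most d(x);
   counting edges forces d(x) = k and then exactly k of them. *)
Lemma moon_moser_side X e n k x y : ham_saturated X e -> #|X| = n -> #|~: X| = n ->
  (0 < k)%N -> (2 * k + 2 <= n)%N -> (forall v, k <= deg e v)%N ->
  (n * (n - k - 1) + (k + 1) ^ 2 < \sum_(v in X) deg e v)%N ->
  x \in X -> y \notin X -> ~~ e x y -> (deg e x <= deg e y)%N ->
  (forall u v, u \in X -> v \notin X -> ~~ e u v ->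
     (deg e u + deg e v <= deg e x + deg e y)%N) ->
  exists S T, [/\ block_complement X e S T, #|S| = k & #|T| = (n - k)%N].
Proof.
move=> sat cX cXC k0 nk dk He xX yX nxy dxy maxd.
have [eC bX nh hp] := sat.
have dsum := deg_sum_le sat cX cXC.
have dn v : (deg e v <= n)%N by exact: deg_le_balanced cX cXC.
set s := deg e x in dxy maxd.
have sn : (2 * s <= n)%N by have := dsum _ _ xX yX nxy; rewrite -/s; lia.
pose A := [set u in X | ~~ e u y].
have AX : A \subset X by apply/subsetP => u; rewrite inE => /andP[].
have AD : forall u, u \in A -> (deg e u <= s)%N.
  by move=> u; rewrite inE => /andP[uX nuy]; have := maxd _ _ uX yX nuy; lia.
have cA : (#|A| + deg e y = n)%N.
  rewrite (deg_bipartiteC bX eC yX) -cX addnC -(cardsID [set u | e u y] X).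
  by congr (_ + _)%N; apply: eq_card => u; rewrite !inE // andbC.
have xA : x \in A by rewrite inE xX.
have sumX (B : {set V}) b : B \subset X -> (forall u, u \in B -> deg e u <= b)%N ->
    (\sum_(v in X) deg e v <= #|B| * b + \sum_(v in X :\: B) deg e v)%N.
  move=> BX Bb; rewrite (big_setID B) /= (setIidPr BX) leq_add2r -sum_nat_const.
  exact: leq_sum.
have cXD (B : {set V}) : B \subset X -> (#|X :\: B| = n - #|B|)%N.
  by move=> BX; rewrite cardsD (setIidPr BX) cX.
have cB (B : {set V}) : B \subset X -> (#|B| <= n)%N.
  by move=> BX; rewrite -cX subset_leq_card.
have sumXn (B : {set V}) b : B \subset X -> (forall u, u \in B -> deg e u <= b)%N ->
    (\sum_(v in X) deg e v <= #|B| * b + (n - #|B|) * n)%N.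
  move=> BX Bb; apply: leq_trans (sumX B b BX Bb) _.
  rewrite leq_add2l -cXD // -sum_nat_const; exact: leq_sum.
have sk : s = k.
  have := dk x; rewrite -/s leq_eqVlt => /orP[/eqP //|ks].
  have := sumXn A s AX AD; apply: contraTeq => _.
  apply: (edge_count_large (k := k)) => //; last exact: cB.
  by have := dsum _ _ xX yX nxy; rewrite -/s ks; move: cA dxy; clear; lia.
rewrite sk in AD.
have cAk : #|A| = k.
  have kA : (k <= #|A|)%N by have := dsum _ _ xX yX nxy; rewrite -/s sk; move: cA; clear; lia.
  apply/eqP; rewrite eqn_leq kA andbT leqNgt; apply/negP => Ak.
  have kAn : (k < #|A| <= n)%N by rewrite Ak cB.
  by have /negP[] := edge_count_wide kAn He; exact: sumXn.
(* Suppose [u] and [v] were not adjacent. Any other vertex outside [A] that misses [v] has degree at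
   most [n - deg e v], so at most [n - 1]; only neighbours of [v] can reach [n]. With deg(u) +
   deg(v) <= n the edge count stays within the threshold. *)
have full u v : u \in X -> u \notin A -> v \notin X -> e u v.
  move=> uX uA vX; apply/negPn/negP => nuv.
  have duv := dsum _ _ uX vX nuv.
  have uXA : u \in X :\: A by rewrite inE uA.
  have := sumX A k AX AD; rewrite (bigD1 u uXA) /= cAk.
  have le2 : (\sum_(w in X :\: A | w != u) deg e w <=
      (n - k - 1) * (n - 1) + deg e v)%N.
    have -> : (n - k - 1 = #|[set w in X :\: A | w != u]|)%N.
      have -> : [set w in X :\: A | w != u] = (X :\: A) :\ u.
        by apply/setP => w; rewrite !inE andbC.
      by have := cardsD1 u (X :\: A); rewrite uXA cXD // cAk; clear; lia.
    have -> : (\sum_(w in X :\: A | w != u) deg e w =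
        \sum_(w in [set w in X :\: A | w != u]) deg e w)%N.
      by apply: eq_bigl => w; rewrite !inE.
    rewrite -sum_nat_const.
    have -> : deg e v = (\sum_w e w v)%N by rewrite degE; apply: eq_bigr => w _; rewrite eC.
    apply: (@leq_trans (\sum_(w in [set w in X :\: A | w != u]) ((n - 1) + e w v))).
      apply: leq_sum => w; rewrite !inE => /andP[/andP[_ wX] _].
      case wv : (e w v); first by have := dn w; clear; lia.
      by have := dk v; have := dsum _ _ wX vX (negbT wv); move: k0; clear; lia.
    rewrite big_split leq_add2l /= [leqRHS](bigID (mem [set w in X :\: A | w != u])) /=.
    exact: leq_addr.
  have kn : (0 < k < n)%N by rewrite k0; clear -k0 nk; lia.
  by apply/negP; exact: (edge_count_missing kn duv He le2).
(* If [v] sees some but not all of [A], it sees at least n - k + 1 vertices, and together with the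
   degree of a missed one, at least k, the sum exceeds n. *)
have all_or_none a a' v : a \in A -> a' \in A -> v \notin X -> e a v -> e a' v.
  move=> aA a'A vX av; apply/negPn/negP => na'v.
  have a'X := subsetP AX _ a'A; have := dsum _ _ a'X vX na'v; have := dk a'.
  suff : (n - k + 1 <= deg e v)%N by move: nk; clear; lia.
  rewrite -[k in (n - k)%N]cAk -cXD // addn1 -[_.+1]add1n.
  have <- : (#|a |: (X :\: A)| = 1 + #|X :\: A|)%N by rewrite cardsU1 inE aA.
  apply: subset_leq_card; apply/subsetP => w; rewrite in_setU1 in_setD inE.
  case/orP=> [/eqP->|/andP[wA wX]].
    by rewrite eC.
  by rewrite eC; apply: full.
exists A, [set v in ~: X | ~~ e x v]; split=> //.
  split=> // [|u v uX vX]; first by apply/subsetP => v; rewrite inE => /andP[].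
  have uAE : (u \in A) = ~~ e u y by rewrite inE uX.
  rewrite uAE !inE vX /=; have [uy|nuy] := boolP (e u y).
    by rewrite full // uAE uy.
  by rewrite /= negbK; apply/idP/idP; apply: all_or_none => //; rewrite uAE.
have <- : #|[set v in ~: X | e x v]| = k.
  rewrite -sk /s (deg_bipartite bX xX); apply: eq_card => v; by rewrite !inE.
rewrite -cXC -(cardsID [set v | e x v] (~: X)).
rewrite [X in (_ = X - _)%N]addnC -addnBA ?subset_leq_card //; last first.
  by apply/subsetP => v; rewrite !inE.
have -> : [set v in ~: X | e x v] = ~: X :&: [set v | e x v] by apply/setP => v; rewrite !inE.
rewrite subnn addn0; apply: eq_card => v; by rewrite !inE andbC.
Qed.

End Degrees.

Section Saturated.
Variable V : finType.
Implicit Types (e : rel V) (X S T : {set V}).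

Fixpoint interleave (s t : seq V) :=
  match s, t with x :: s', y :: t' => x :: y :: interleave s' t' | _, _ => [::] end.

Lemma perm_interleave s t : size s = size t -> perm_eq (interleave s t) (s ++ t).
Proof.
elim: s t => [|x s IH] [|y t] //= [/IH/permP pst].
by apply/permP => P; rewrite /= count_cat /= pst count_cat; congr (_ + _)%N; rewrite addnCA.
Qed.

(** Otherwise [e] contains K_{n,n}, where alternating between enumerations of the two sides gives a
    Hamiltonian cycle. *)
Lemma exists_nonadjacent X e n : symmetric e -> ~~ hamcyc e ->
  #|X| = n -> #|~: X| = n -> (0 < n)%N ->
  exists x y, [/\ x \in X, y \notin X & ~~ e x y].
Proof.
move=> eC nh cX cXC n0.
have [/existsP[x /existsP[y /and3P[xX yX nxy]]]|all_e] :=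
  boolP [exists x, exists y, [&& x \in X, y \notin X & ~~ e x y]].
  by exists x, y.
have {}all_e x y : x \in X -> y \notin X -> e x y.
  move=> xX yX; apply: contraR all_e => nxy.
  by apply/existsP; exists x; apply/existsP; exists y; rewrite xX yX.
case/negP: nh; pose c := interleave (enum X) (enum (~: X)).
have sz : size (enum X) = size (enum (~: X)) by rewrite -!cardE cX.
have pc : perm_eq c (enum X ++ enum (~: X)) := perm_interleave sz.
apply/hamcycP; exists c; split.
- have gen s t y0 : size s = size t -> {subset s <= X} -> {subset t <= ~: X} ->
      y0 \notin X -> path e y0 (interleave s t) /\ last y0 (interleave s t) \notin X.
    elim: s t y0 => [|x s IH] [|y t] y0 //= [szst] sX tX y0X.
    have xX : x \in X by apply: sX; rewrite mem_head.
    have yX : y \notin X by have := tX y (mem_head _ _); rewrite inE.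
    have [||pt lt] := IH t y szst _ _ yX.
    + by move=> z zs; apply: sX; rewrite inE zs orbT.
    + by move=> z zs; apply: tX; rewrite inE zs orbT.
    by rewrite pt eC !all_e.
  have [y0 y0X] : exists y0, y0 \in ~: X by apply/card_gt0P; rewrite cXC.
  have [|||pc0 lc0] := gen (enum X) (enum (~: X)) y0 sz.
  + by move=> z; rewrite mem_enum.
  + by move=> z; rewrite mem_enum.
  + by rewrite inE in y0X.
  rewrite (cycle_path y0) -/c.
  have [] // := gen (enum X) (enum (~: X)) (last y0 c) sz.
  + by move=> z; rewrite mem_enum.
  + by move=> z; rewrite mem_enum.
- rewrite (perm_uniq pc) cat_uniq !enum_uniq andbT /=.
  by apply/hasPn => z; rewrite !mem_enum inE.
- by rewrite (perm_size pc) size_cat -!cardE cardsC.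
Qed.

(** Take a non-adjacent pair of maximal degree sum. Its smaller degree may be on either side, hence
    the two alternatives. *)
Lemma moon_moser X e n k : ham_saturated X e -> #|X| = n -> #|~: X| = n ->
  (0 < k)%N -> (2 * k + 2 <= n)%N -> (forall v, k <= deg e v)%N ->
  (n * (n - k - 1) + (k + 1) ^ 2 < \sum_(v in X) deg e v)%N ->
  exists S T, [/\ block_complement X e S T \/ block_complement (~: X) e S T,
    #|S| = k & #|T| = (n - k)%N].
Proof.
move=> sat cX cXC k0 nk dk He; have [eC bX nh hp] := sat.
have n0 : (0 < n)%N by move: nk; clear; lia.
have [x1 [y1 [x1X y1X nxy1]]] := exists_nonadjacent eC nh cX cXC n0.
pose P (u : V * V) := [&& u.1 \in X, u.2 \notin X & ~~ e u.1 u.2].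
have P1 : P (x1, y1) by rewrite /P x1X y1X.
have [[x y] /= /and3P[/= xX yX nxy] maxd] := arg_maxnP (fun u => deg e u.1 + deg e u.2)%N P1.
have [dxy|dyx] := leqP (deg e x) (deg e y).
  have [|S [T [bST cS cT]]] := moon_moser_side sat cX cXC k0 nk dk He xX yX nxy dxy.
    by move=> u v uX vX nuv; apply: (maxd (u, v)); rewrite /P uX vX.
  by exists S, T; split=> //; left.
have yXC : y \in ~: X by rewrite inE.
have xXC : x \notin ~: X by rewrite inE xX.
have nyx : ~~ e y x by rewrite eC.
have cXCC : #|~: ~: X| = n by rewrite setCK.
have He' : (n * (n - k - 1) + (k + 1) ^ 2 < \sum_(v in ~: X) deg e v)%N.
  by rewrite -sum_deg_bipartite.
have [|S [T [bST cS cT]]] := moon_moser_side (ham_saturatedC sat) cXC cXCC k0 nk dk He'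
    yXC xXC nyx (ltnW dyx).
  move=> u v; rewrite !inE negbK => uX vX nuv; rewrite addnC [leqRHS]addnC.
  by apply: (maxd (v, u)); rewrite /P vX uX eC.
by exists S, T; split=> //; right.
Qed.

End Saturated.

(** * Cycles that miss just two adjacent vertices *)

Section NearHamiltonianCycle.
Variable V : finType.
Implicit Types (e : rel V) (X S T : {set V}) (A : seq V).

(** [S] together with its shift is closed under [next], so it fills the cycle. *)
Lemma next_two_step_closed A S v t : uniq A -> v \in A -> t \in A -> v \in S ->
  {in S, forall u, next A (next A u) \in S} -> t \in S :|: next A @: S.
Proof.
move=> uA vA tA vS cS.
have := fconnect_cycle (cycle_next uA) vA t; rewrite tA => /iter_findex <-.
elim: (findex _ _ _) => [|m]; first by rewrite inE vS.
rewrite iterS inE => /orP[uS|/imsetP[u uS ->]]; rewrite inE.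
  by rewrite imset_f ?orbT.
by rewrite cS.
Qed.

(* In the quasi-complement, S and T span a complete bipartite component. *)
Definition isolated_block X e S T :=
  [/\ S \subset X, T \subset ~: X,
      forall x y, x \in S -> y \notin X -> e x y = (y \notin T)
    & forall x y, x \in X -> y \in T -> e x y = (x \notin S)].

Definition gamma2_labelling X e (ts bs : 'I_4 -> V) :=
  [/\ injective ts, injective bs, forall i, ts i \in X, forall i, bs i \notin X
    & forall i j, e (ts i) (bs j) = [|| i == j, i == ord0 | j == ord0]].

Section Half.
Variables (X : {set V}) (e : rel V) (n : nat) (A : seq V) (a b : V).
Hypotheses (eC : symmetric e) (bX : bipartite_rel X e) (nh : ~~ hamcyc e).
Hypotheses (cX : #|X| = n) (cXC : #|~: X| = n).
Hypotheses (cA : cycle e A) (uA : uniq (a :: b :: A)) (sA : (size A).+2 = #|V|).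
Hypotheses (aX : a \in X) (bXC : b \notin X) (ab : e a b).
Hypotheses (dab : deg e a + deg e b = n) (da : 1 < deg e a) (db : 1 < deg e b).
Hypothesis dsum : forall x y, x \in X -> y \notin X -> ~~ e x y -> deg e x + deg e y = n.

(** With [c] and [d] the two vertices off the cycle, these are the neighbours of [c] on it. [S] and
    [T] belong to [a] and [b]; [U] and [W] are the remaining cycle vertices of the two sides,
    non-adjacent to [b] and to [a] respectively. *)
Definition attached c d := [set v | e c v & v != d].

Let S := attached a b.
Let T := attached b a.
Let U := [set u in X | (u != a) && (u \notin T)].
Let W := [set w in ~: X | (w != b) && (w \notin S)].

Let uA' : uniq A. Proof. by case/and3P: uA. Qed.

Lemma mem_rest v : v != a -> v != b -> v \in A.
Proof.
move=> va vb; have : v \in a :: b :: A.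
  have /subset_cardP/(_ (subset_predT _)) -> // : #|a :: b :: A| = #|V|.
  by rewrite -sA; exact/card_uniqP.
by rewrite !inE (negbTE va) (negbTE vb).
Qed.

Lemma rest_neq v : v \in A -> (v != a) && (v != b).
Proof.
move=> vA; case/and3P: uA; rewrite inE negb_or => /andP[_ aA] bA _.
by apply/andP; split; apply: contraTneq vA => ->.
Qed.

Lemma no_insert B : cycle e B -> perm_eq B (a :: b :: A) -> False.
Proof. by move=> cB pB; case/negP: nh; apply: (perm_hamcyc cB pB). Qed.

Lemma attached_a_color v : v \in S -> v \notin X.
Proof. by rewrite inE => /andP[/bX]; rewrite aX; case: (v \in X). Qed.

Lemma attached_b_color v : v \in T -> v \in X.
Proof. by rewrite inE => /andP[/bX]; rewrite (negbTE bXC); case: (v \in X). Qed.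

Lemma attached_a_rest v : v \in S -> v \in A.
Proof.
move=> vS; apply: mem_rest; last by move: vS; rewrite inE => /andP[].
by apply: contraNneq (attached_a_color vS) => ->.
Qed.

Lemma next_color v : v \in A -> (next A v \in X) = (v \notin X).
Proof. by move=> vA; have := bX (next_cycle cA vA); case: (v \in X); case: (next A v \in X). Qed.

Lemma prev_color v : v \in A -> (prev A v \in X) = (v \notin X).
Proof. by move=> vA; have := bX (prev_cycle cA vA); case: (v \in X); case: (prev A v \in X). Qed.

(** If the successor of a neighbour of [a] were adjacent to [b], the edge [ab] could be inserted
    between the two. *)
Lemma next_attached v : v \in S -> next A v \in U.
Proof.
move=> vS; have vA := attached_a_rest vS.
rewrite !inE next_color // (attached_a_color vS) /=.
have nA : next A v \in A by rewrite mem_next.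
have /andP[na _] := rest_neq nA; rewrite na /= andbT; apply/negP => bn.
have [||||||B cB pB] := @cycle_insert _ e A a b (next A v) => //.
  by rewrite prev_next // eC; move: vS; rewrite inE => /andP[].
exact: no_insert cB pB.
Qed.

Lemma prev_attached v : v \in S -> prev A v \in U.
Proof.
move=> vS; have vA := attached_a_rest vS.
rewrite !inE prev_color // (attached_a_color vS) /=.
have nA : prev A v \in A by rewrite mem_prev.
have /andP[na _] := rest_neq nA; rewrite na /= andbT; apply/negP => bn.
have [||||||B cB pB] := @cycle_insert _ e A b a v => //.
- by rewrite eC.
- by rewrite eC.
- by move: vS; rewrite inE => /andP[].
apply: (no_insert cB); apply: perm_trans pB _.
by rewrite -[b :: a :: A]/([:: b] ++ [:: a] ++ A) perm_catCA.
Qed.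

Lemma card_attached : #|S| = (deg e a).-1.
Proof.
have -> : S = [set v | e a v] :\ b by apply/setP => v; rewrite !inE andbC.
by have := cardsD1 b [set v | e a v]; rewrite inE ab -/(deg e a) => ->.
Qed.

Lemma card_free : #|U| = deg e a.
Proof.
have -> : U = X :\: [set v | e b v].
  apply/setP => u; rewrite !inE; case: (eqVneq u a) => [->|ua] /=.
    by rewrite eC ab andbF.
  by rewrite andbT andbC.
rewrite cardsD cX; have -> : X :&: [set v | e b v] = [set v | e b v].
  apply/setIidPr/subsetP => v; rewrite inE => /bX.
  by rewrite (negbTE bXC); case: (v \in X).
by rewrite -/(deg e b) -dab addnK.
Qed.

Lemma free_rest u : u \in U -> u \in A.
Proof.
rewrite inE => /and3P[uX ua _]; apply: mem_rest => //.
by apply: contraTneq uX => ->.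
Qed.

(** [next] maps [S] injectively into [U]. Because deg(a) + deg(b) = n, the set [U] has deg(a)
    elements, exactly one more than [S]. *)
Lemma missed_next : exists be, [/\ be \in U, be \notin next A @: S &
  forall u, u \in U -> u != be -> prev A u \in S].
Proof.
have sub : next A @: S \subset U by apply/subsetP => _ /imsetP[v vS ->]; exact: next_attached.
have := cardsD U (next A @: S); rewrite (setIidPr sub) card_free card_imset; last first.
  exact: can_inj (prev_next uA').
rewrite card_attached; have -> : (deg e a - (deg e a).-1 = 1)%N by move: da; clear; lia.
move=> /eqP/cards1P[be beE]; exists be.
have : be \in U :\: next A @: S by rewrite beE inE.
rewrite inE => /andP[nb bU]; split=> // u uU ub.
have : u \notin U :\: next A @: S by rewrite beE inE.
by rewrite inE uU andbT negbK => /imsetP[v vS ->]; rewrite prev_next.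
Qed.

Lemma missed_prev : exists al, [/\ al \in U, al \notin prev A @: S &
  forall u, u \in U -> u != al -> next A u \in S].
Proof.
have sub : prev A @: S \subset U by apply/subsetP => _ /imsetP[v vS ->]; exact: prev_attached.
have := cardsD U (prev A @: S); rewrite (setIidPr sub) card_free card_imset; last first.
  exact: can_inj (next_prev uA').
rewrite card_attached; have -> : (deg e a - (deg e a).-1 = 1)%N by move: da; clear; lia.
move=> /eqP/cards1P[be beE]; exists be.
have : be \in U :\: prev A @: S by rewrite beE inE.
rewrite inE => /andP[nb bU]; split=> // u uU ub.
have : u \notin U :\: prev A @: S by rewrite beE inE.
by rewrite inE uU andbT negbK => /imsetP[v vS ->]; rewrite next_prev.
Qed.

(** If the same vertex were missed in both directions, two steps along the cycle would lead from [S]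
    back into [S], so [S] and its shift would fill the cycle; but the missed vertex lies in
    neither. *)
Lemma missed_distinct : exists al be, [/\ al != be, al \in U, be \in U,
  forall u, u \in U -> u != al -> next A u \in S &
  forall u, u \in U -> u != be -> prev A u \in S].
Proof.
have [be [beU nbe pbe]] := missed_next; have [al [alU _ nal]] := missed_prev.
exists al, be; split=> //; apply/eqP => alE.
have [v vS] : exists v, v \in S by apply/card_gt0P; rewrite card_attached; move: da; clear; lia.
have : be \in S :|: next A @: S.
  apply: (next_two_step_closed uA' (attached_a_rest vS)) => //; first exact: free_rest.
  move=> u uS; apply: nal; first exact: next_attached.
  by apply: contraNneq nbe => nu; rewrite -alE -nu imset_f.
rewrite inE (negbTE nbe) orbF => /attached_a_color.
by move: beU; rewrite !inE => /and3P[->].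
Qed.

Lemma chord_prev u w : u \in U -> w \in W -> e u w -> ~~ ((prev A u \in S) && (prev A w \in T)).
Proof.
move=> uU wW uw; apply/negP => /andP[pu pw].
have wA : w \in A.
  move: wW; rewrite !inE => /and3P[wX wb _]; apply: mem_rest => //.
  by apply: contraNneq wX => ->.
have [|||||||||B cB pB] := @cycle_insert_chord _ e eC A a b u w => //.
- exact: free_rest.
- apply: contraTneq wW => <-; rewrite !inE; move: uU; rewrite inE => /andP[-> _] //.
- by rewrite eC; move: pu; rewrite inE => /andP[].
- by rewrite eC; move: pw; rewrite inE => /andP[].
exact: no_insert cB pB.
Qed.

Lemma chord_next u w : u \in U -> w \in W -> e u w -> ~~ ((next A u \in S) && (next A w \in T)).
Proof.
move=> uU wW uw; apply/negP => /andP[pu pw].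
have wA : w \in A.
  move: wW; rewrite !inE => /and3P[wX wb _]; apply: mem_rest => //.
  by apply: contraNneq wX => ->.
have [|||||||||B cB pB] := @cycle_insert_chord _ e eC (rev A) a b u w => //.
- by rewrite rev_uniq.
- by rewrite rev_cycle (eq_cycle (e' := e)) // => ? ?; exact: eC.
- by rewrite mem_rev free_rest.
- by rewrite mem_rev.
- apply: contraTneq wW => <-; rewrite !inE; move: uU; rewrite inE => /andP[-> _] //.
- by rewrite prev_rev // eC; move: pu; rewrite inE => /andP[].
- by rewrite prev_rev // eC; move: pw; rewrite inE => /andP[].
apply: (no_insert cB); apply: perm_trans pB _.
by rewrite !perm_cons perm_rev.
Qed.

(** A vertex of [U] misses [b], so its degree is n - deg(b) = deg(a), one more than [S] can
    supply. *)
Lemma free_nbr u : u \in U -> exists w, [/\ w \in W & e u w].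
Proof.
rewrite inE => /and3P[uX ua uT].
have nub : ~~ e u b.
  by apply: contraNN uT; rewrite inE eC => ->.
have du : deg e u = deg e a by have := dsum uX bXC nub; move: dab; clear; lia.
have [w /andP[ew wS]|none] := pickP (fun w => e u w && (w \notin S)).
  have wX : w \notin X by have := bX ew; rewrite uX; case: (w \in X).
  by exists w; split=> //; rewrite in_set in_setC wX wS andbT; apply: contraNneq nub => <-.
have : (deg e u <= #|S|)%N.
  apply: subset_leq_card; apply/subsetP => w; rewrite inE => uw.
  by have := none w; rewrite uw => /negbFE.
by rewrite du card_attached; move: da; clear; lia.
Qed.

End Half.

Lemma attached_card1 e c d : e c d -> deg e c = 2 ->
  exists v, attached e c d = [set v].
Proof.
move=> cd dc; apply/cards1P.
have -> : attached e c d = [set v | e c v] :\ d by apply/setP => v; rewrite !inE andbC.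
by have := cardsD1 d [set v | e c v]; rewrite inE cd -/(deg e c) dc => -[->].
Qed.

(* Each of S and T (the neighbours of a, resp. b, on the cycle) leaves room for
   exactly one extra vertex when shifted along the cycle in either direction, and
   a chord uw with both predecessors, or both successors, attached to the edge ab
   yields a Hamiltonian cycle. So the only edges between the two sets of
   remaining vertices join the exceptional vertices. *)
Lemma near_ham_cycle_gamma2 X e n A a b : symmetric e -> bipartite_rel X e -> ~~ hamcyc e ->
  #|X| = n -> #|~: X| = n -> cycle e A -> uniq (a :: b :: A) -> (size A).+2 = #|V| ->
  a \in X -> b \notin X -> e a b -> (deg e a + deg e b = n)%N ->
  (1 < deg e a)%N -> (1 < deg e b)%N ->
  (forall x y, x \in X -> y \notin X -> ~~ e x y -> (deg e x + deg e y = n)%N) ->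
  n = 4 /\ exists ts bs, gamma2_labelling X e ts bs.
Proof.
move=> eC bX nh cX cXC cA uA sA aX bXC ab dab da db dsum.
(* The preceding lemmas are also needed with [a] and [b], and with them the two sides, exchanged. *)
have bX' := bipartite_relC bX; have cXCC : #|~: ~: X| = n by rewrite setCK.
have uA' : uniq (b :: a :: A).
  by move: uA; rewrite -[b :: a :: A]/([:: b] ++ [:: a] ++ A) uniq_catCA.
have aXC' : a \notin ~: X by rewrite inE aX.
have bX1 : b \in ~: X by rewrite inE.
have ba : e b a by rewrite eC.
have dba : (deg e b + deg e a = n)%N by rewrite addnC.
have dsum' x y : x \in ~: X -> y \notin ~: X -> ~~ e x y -> (deg e x + deg e y = n)%N.
  by rewrite !inE negbK eC addnC => xX yX; exact: dsum.
pose S := attached e a b; pose T := attached e b a.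
pose U := [set u in X | (u != a) && (u \notin T)].
pose W := [set w in ~: X | (w != b) && (w \notin S)].
have U'E : [set u in ~: ~: X | (u != a) && (u \notin T)] = U by rewrite setCK.
have [al [be [albe alU beU nal pbe]]] :=
  missed_distinct eC bX nh cX cA uA sA aX bXC ab dab da.
have [ga [de [gade gaW deW nga pde]]] :=
  missed_distinct eC bX' nh cXC cA uA' sA bX1 aXC' ba dba db.
rewrite -/S -/T -/U -/W in alU beU gaW deW nal pbe nga pde.
have UW u w : u \in U -> w \in W -> e u w ->
    ((u == be) && (w == ga)) || ((u == al) && (w == de)).
  move=> uU wW uw.
  have := chord_prev eC nh cA uA sA aX bXC ab uU wW uw.
  have := chord_next eC nh cA uA sA aX bXC ab uU wW uw.
  rewrite !negb_and -/S -/T.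
  have [->|ual] := eqVneq u al.
    rewrite (negbTE albe) /=; have [//|wde] := eqVneq w de.
    by rewrite (pde _ wW wde) pbe // orbF.
  rewrite (nal _ uU ual) /= => ngw.
  have [->|wga] := eqVneq w ga; last by rewrite nga in ngw.
  have [//|ube] := eqVneq u be.
  by rewrite (pbe _ uU ube) pde //=.
have cU := card_free eC bX cX bXC ab dab.
have cW := card_free eC bX' cXC aXC' ba dba.
rewrite -/U -/W in cU cW.
have nbrU u : u \in U -> exists2 w, w \in W & e u w.
  by move=> uU; have [w [wW uw]] := free_nbr eC bX bXC ab dab da dsum uU; exists w.
have nbrW w : w \in W -> exists2 u, u \in U & e w u.
  move=> wW; have [u [uU uw]] := free_nbr eC bX' aXC' ba dba db dsum' wW.
  by exists u => //; rewrite -U'E.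
have SX v : v \in S -> v \notin X := attached_a_color bX aX (v := v).
have TX v : v \in T -> v \in X := attached_b_color bX bXC (v := v).
have inS v : (v \in S) = e a v && (v != b) by rewrite inE.
have inT v : (v \in T) = e b v && (v != a) by rewrite inE.
have inU u : (u \in U) = [&& u \in X, u != a & u \notin T] by rewrite in_set.
have inW w : (w \in W) = [&& w \notin X, w != b & w \notin S] by rewrite in_set in_setC.
(* Every vertex of [U] has a neighbour in [W], so by [UW] it is one of the two exceptional ones, and
   likewise for [W]. Since the sizes of these sets are the degrees of [a] and [b], both degrees are
   2 and n = 4. *)
have Usub : U \subset [set al; be].
  apply/subsetP => u uU; have [w wW uw] := nbrU _ uU.
  by have := UW _ _ uU wW uw; rewrite !inE => /orP[]/andP[-> _]; rewrite ?orbT.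
have Wsub : W \subset [set ga; de].
  apply/subsetP => w wW; have [u uU uw] := nbrW _ wW; rewrite eC in uw.
  by have := UW _ _ uU wW uw; rewrite !inE => /orP[]/andP[_ ->]; rewrite ?orbT.
have da2 : deg e a = 2.
  have := subset_leq_card Usub; rewrite cU cards2 albe; move: da; clear; lia.
have db2 : deg e b = 2.
  have := subset_leq_card Wsub; rewrite cW cards2 gade; move: db; clear; lia.
have n4 : n = 4 by rewrite -dab da2 db2.
split=> //.
have [v1 SE] := attached_card1 ab da2; have [t1 TE] := attached_card1 ba db2.
rewrite -/S -/T in SE TE.
clearbody U W S T.
have v1S : v1 \in S by rewrite SE inE.
have t1T : t1 \in T by rewrite TE inE.
have v1X := SX _ v1S; have t1X := TX _ t1T.
have UX u : u \in U -> [/\ u \in X, u != a & u \notin T] by rewrite inU => /and3P[].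
have WX w : w \in W -> [/\ w \notin X, w != b & w \notin S] by rewrite inW => /and3P[].
have av1 : e a v1 by move: v1S; rewrite inS => /andP[].
have v1b : v1 != b by move: v1S; rewrite inS => /andP[].
have bt1 : e b t1 by move: t1T; rewrite inT => /andP[].
have t1a : t1 != a by move: t1T; rewrite inT => /andP[].
have Unb u : u \in U -> e u b = false.
  by case/UX => _ ua; rewrite inT ua andbT eC => /negbTE.
have Wna w : w \in W -> e a w = false.
  by case/WX => _ wb; rewrite inS wb andbT => /negbTE.
have bega : e be ga.
  have [w wW uw] := nbrU _ beU; have := UW _ _ beU wW uw.
  by rewrite eqxx [be == al]eq_sym (negbTE albe) orbF => /eqP <-.
have alde : e al de.
  have [w wW uw] := nbrU _ alU; have := UW _ _ alU wW uw.
  by rewrite eqxx (negbTE albe) => /eqP <-.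
have bede : e be de = false.
  apply/negP => h; have := UW _ _ beU deW h.
  by rewrite [de == ga]eq_sym (negbTE gade) andbF [be == al]eq_sym (negbTE albe).
have alga : e al ga = false.
  by apply/negP => h; have := UW _ _ alU gaW h; rewrite (negbTE albe) (negbTE gade) andbF.
have degU u : u \in U -> deg e u = 2.
  move=> uU; have [uX _ _] := UX _ uU; have := dsum u b uX bXC.
  by rewrite Unb // n4 db2 => /(_ isT); clear; lia.
have degW w : w \in W -> deg e w = 2.
  move=> wW; have [wX _ _] := WX _ wW; have := dsum a w aX wX.
  by rewrite Wna // n4 da2 => /(_ isT); clear; lia.
have two (u w z : V) : deg e u = 2 -> (forall v, e u v -> v = w \/ v = z) -> e u z.
  move=> du sub; apply/negPn/negP => nuz.
  have : (deg e u <= #|[set w]|)%N.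
    apply: subset_leq_card; apply/subsetP => v; rewrite !inE => uv.
    by case: (sub _ uv) => [->//|vz]; rewrite vz (negbTE nuz) in uv.
  by rewrite du cards1.
have Xcase v : v \in X -> [|| v == t1, v == a, v == be | v == al].
  move=> vX; have [//|vt] := eqVneq v t1; have [//|va] := eqVneq v a.
  have : v \in U by rewrite inU vX va TE inE vt.
  by move/(subsetP Usub); rewrite !inE orbC.
have Ycase v : v \notin X -> [|| v == v1, v == b, v == ga | v == de].
  move=> vX; have [//|vt] := eqVneq v v1; have [//|va] := eqVneq v b.
  have : v \in W by rewrite inW vX va SE inE vt.
  by move/(subsetP Wsub); rewrite !inE.
have colX u v : u \in X -> e u v -> v \notin X by move=> uX /bX; rewrite uX; case: (v \in X).
have colY u v : u \notin X -> e u v -> v \in X.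
  by move=> uX /bX; rewrite (negbTE uX); case: (v \in X).
have Uv1 u w : u \in U -> w \in W -> (forall z, z \in W -> e u z -> z = w) -> e u v1.
  move=> uU wW uw; apply: (two u w v1 (degU _ uU)) => v uv; have [uX _ _] := UX _ uU.
  have [/eqP ->|vv1] := boolP (v == v1); first by right.
  left; apply: uw => //; rewrite inW (colX _ _ uX uv) SE inE vv1 andbT /=.
  by apply: contraTneq uv => ->; rewrite Unb.
have bev1 : e be v1.
  apply: (Uv1 be ga) => // z zW bz; have := UW _ _ beU zW bz.
  by rewrite [be == al]eq_sym (negbTE albe) orbF => /andP[_ /eqP].
have alv1 : e al v1.
  by apply: (Uv1 al de) => // z zW bz; have := UW _ _ alU zW bz; rewrite (negbTE albe) eqxx => /eqP.
have Wt1 w u : w \in W -> u \in U -> (forall z, z \in U -> e z w -> z = u) -> e w t1.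
  move=> wW uU uw; apply: (two w u t1 (degW _ wW)) => v uv; have [wX _ _] := WX _ wW.
  have [/eqP ->|vv1] := boolP (v == t1); first by right.
  left; apply: uw; last by rewrite eC.
  rewrite inU (colY _ _ wX uv) TE inE vv1 andbT /=.
  by apply: contraTneq uv => ->; rewrite eC Wna.
have gat1 : e ga t1.
  apply: (Wt1 ga be) => // z zU bz; have := UW _ _ zU gaW bz.
  by rewrite (negbTE gade) andbF orbF => /andP[/eqP].
have det1 : e de t1.
  apply: (Wt1 de al) => // z zU bz; have := UW _ _ zU deW bz.
  by rewrite [de == ga]eq_sym (negbTE gade) andbF => /andP[/eqP].
have [_ beNa _] := UX _ beU; have [_ alNa _] := UX _ alU.
have [_ gaNb gaNS] := WX _ gaW; have [_ deNb deNS] := WX _ deW.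
have [beX _ beNT] := UX _ beU; have [alX _ alNT] := UX _ alU.
have [gaX _ _] := WX _ gaW; have [deX _ _] := WX _ deW.
rewrite TE inE in beNT; rewrite TE inE in alNT; rewrite SE inE in gaNS; rewrite SE inE in deNS.
(* Non-adjacency would mean degree sum 4, while [t1] has the neighbours [b], [ga], [de] and [v1] has
   the neighbours [a], [be], [al]. *)
have t1v1 : e t1 v1.
  apply/negPn/negP => nh1; have := dsum _ _ t1X v1X nh1.
  have : (2 < deg e t1)%N.
    have <- : #|b |: [set ga; de]| = 3.
      by rewrite cardsU1 cards2 gade !inE negb_or ![b == _]eq_sym gaNb deNb.
    apply: subset_leq_card; apply/subsetP => v; rewrite !inE => /or3P[]/eqP->.
    - by rewrite eC.
    - by rewrite eC.
    - by rewrite eC.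
  have : (2 < deg e v1)%N.
    have <- : #|a |: [set be; al]| = 3.
      by rewrite cardsU1 cards2 (eq_sym be) albe !inE negb_or ![a == _]eq_sym beNa alNa.
    apply: subset_leq_card; apply/subsetP => v; rewrite !inE => /or3P[]/eqP->.
    - by rewrite eC.
    - by rewrite eC.
    - by rewrite eC.
  by rewrite n4; clear; lia.
(* The hubs are [t1] and [v1], the neighbours of [b] and [a] on the cycle. The matching between the
   other vertices pairs [a] with [b], [be] with [ga] and [al] with [de]. *)
exists (fun i : 'I_4 => nth a [:: t1; a; be; al] i), (fun i : 'I_4 => nth b [:: v1; b; ga; de] i).
split.
- move=> i j /eqP; rewrite nth_uniq ?ltn_ord // => [/eqP/val_inj //|] /=.
  by rewrite !inE !negb_or t1a ![t1 == _]eq_sym beNT alNT ![a == _]eq_sym beNa alNa eq_sym albe.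
- move=> i j /eqP; rewrite nth_uniq ?ltn_ord // => [/eqP/val_inj //|] /=.
  by rewrite !inE !negb_or v1b ![v1 == _]eq_sym gaNS deNS ![b == _]eq_sym gaNb deNb gade.
- by case=> [[|[|[|[|]]]]].
- by case=> [[|[|[|[|]]]]].
- case=> [[|[|[|[|//]]]] ?] [[|[|[|[|//]]]] ?]; rewrite -?(inj_eq val_inj) /=
    ?(Wna _ gaW) ?(Wna _ deW) ?(Unb _ beU) ?(Unb _ alU) ?t1v1 ?[e t1 _]eC //.
Qed.

End NearHamiltonianCycle.

(** * Graphs whose non-adjacent pairs across the sides have degree sum n *)

Section DegreeSumN.
Variables (V : finType) (X : {set V}) (e : rel V) (n : nat).
Hypotheses (sat : ham_saturated X e) (cX : #|X| = n) (cXC : #|~: X| = n).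
Hypothesis dsum : forall x y, x \in X -> y \notin X -> ~~ e x y -> deg e x + deg e y = n.

(** The two disjoint index sets of [ham_path_no_crossing] now have sizes adding up to [n], so they
    partition ['I_n]. *)
Lemma ham_path_complementary x y p (i : 'I_n) : x \in X -> y \notin X -> ~~ e x y ->
  path e x p -> last x p = y -> uniq (x :: p) -> (size p).+1 = #|V| ->
  e (xs x p i) y = ~~ e x (ys x p i).
Proof.
move=> xX yX nxy pp lp up sp; have [eC bX nh _] := sat.
have := dsum xX yX nxy; rewrite (deg_bipartite bX xX) (deg_bipartiteC bX eC yX).
rewrite (card_ys bX nh cX cXC xX pp up sp (e x)) (card_xs bX nh cX cXC xX pp up sp (e^~ y)).
set I := [set i | _]; set J := [set i | _] => IJ.
have [ei|nei] := boolP (e x (ys x p i)).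
  by apply/negbTE; exact: (ham_path_no_crossing eC nh cX cXC xX pp lp up sp (ltn_ord i) ei).
have IJ0 : I :&: J = set0.
  apply/setP => j; rewrite !inE; apply/negP => /andP[xj]; apply/negP.
  exact: (ham_path_no_crossing eC nh cX cXC xX pp lp up sp).
have : i \in I :|: J.
  have cU : #|I :|: J| = n by rewrite -[RHS]IJ -cardsUI IJ0 cards0 addn0.
  suff -> : I :|: J = setT by rewrite inE.
  by apply/eqP; rewrite eqEcard subsetT cardsT card_ord cU leqnn.
by rewrite !inE (negbTE nei).
Qed.

(** At such a gap [x] sees [ys j.+1] and, by complementarity, [y] sees [xs j]. Leaving out the
    consecutive vertices [ys j] and [xs j.+1] therefore closes the rest of the path into a cycle. *)
Lemma ham_path_gap x y p j : x \in X -> y \notin X -> ~~ e x y ->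
  path e x p -> last x p = y -> uniq (x :: p) -> (size p).+1 = #|V| ->
  (j.+1 < n)%N -> ~~ e x (ys x p j) -> e x (ys x p j.+1) ->
  n = 4 /\ exists ts bs, gamma2_labelling X e ts bs.
Proof.
move=> xX yX nxy pp lp up sp jn nI I'; have [eC bX nh _] := sat.
have jn' := ltnW jn.
have cV := card_balanced cX cXC.
have cmp i (lti : (i < n)%N) :=
  ham_path_complementary (Ordinal lti) xX yX nxy pp lp up sp.
have /= cj := cmp j jn'; have /= cj1 := cmp j.+1 jn; rewrite nI in cj; rewrite I' in cj1.
pose c := x :: p; pose a := xs x p j.+1; pose b := ys x p j.
pose A1 := take j.*2.+1 c; pose A2 := drop j.*2.+3 c.
have sc : size c = n.*2 by rewrite /= sp.
have s1 : (j.*2.+1 < size c)%N by rewrite sc; move: jn; clear; lia.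
have s2 : (j.*2.+2 < size c)%N by rewrite sc; move: jn; clear; lia.
have cE : c = A1 ++ b :: a :: A2.
  by rewrite -[LHS](cat_take_drop j.*2.+1) (drop_nth x s1) (drop_nth x s2).
have s3 : (j.*2.+3 < size c)%N by rewrite sc; move: jn; clear; lia.
have A10 : A1 != [::] by [].
have A20 : A2 != [::] by rewrite /A2 (drop_nth x s3).
have sorted_c : sorted e c by [].
have lA2 : last x A2 = y.
  by rewrite -lp -[last x p]/(last x c) cE last_cat /=; case: (A2) A20.
have cyc : cycle e (rev A1 ++ A2).
  apply: (cycle_flip_prefix (x0 := x)) => //.
  - exact: take_sorted.
  - exact: drop_sorted.
  - by rewrite head_drop.
  - by rewrite lA2 last_take // ltnW.
have pA : perm_eq (a :: b :: rev A1 ++ A2) c.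
  rewrite cE; apply/permP => P; rewrite /= !count_cat count_rev /=.
  by move: (P a) (P b) (count P A1) (count P A2) => m1 m2 m3 m4; clear; lia.
have aX : a \in X by exact: (xs_X bX cX cXC xX pp sp jn).
have bX' : b \notin X by exact: (ys_X bX nh cX cXC xX pp up sp jn').
(* As [b] misses [x] and [a] misses [y], these degree sums give deg(a) = deg(x) and deg(b) =
   deg(y). *)
have xb := dsum xX bX' nI; have ay := dsum aX yX (negbT cj1).
have xy := dsum xX yX nxy.
have n1 : (n.-1 < n)%N by rewrite prednK // (leq_ltn_trans _ jn).
apply: (near_ham_cycle_gamma2 (A := rev A1 ++ A2) (a := a) (b := b)) => //.
- by rewrite (perm_uniq pA).
- by rewrite -sp -[(size p).+1]/(size c) -(perm_size pA).
- by rewrite eC; exact: (e_ys_xs nh cX cXC xX pp up sp jn).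
- by move: xb ay xy; clear; lia.
- have -> : deg e a = deg e x by move: ay xy; clear; lia.
  have <- : #|[set ys x p 0; ys x p j.+1]| = 2.
    rewrite cards2; suff -> : ys x p 0 != ys x p j.+1 by [].
    apply/eqP => /(ys_inj nh cX cXC xX pp up sp).
    by rewrite !inE (leq_ltn_trans _ jn) // jn => /(_ isT isT).
  apply: subset_leq_card; apply/subsetP => v; rewrite !inE => /orP[]/eqP-> //.
  exact: (e_x_ys0 nh cX cXC xX pp up sp).
- have -> : deg e b = deg e y by move: xb xy; clear; lia.
  have <- : #|[set xs x p j; xs x p n.-1]| = 2.
    rewrite cards2; suff -> : xs x p j != xs x p n.-1 by [].
    apply/eqP => /(xs_inj cX cXC up sp); rewrite !inE n1 jn' => /(_ isT isT).
    by move: jn; clear; lia.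
  apply: subset_leq_card; apply/subsetP => v; rewrite !inE => /orP[]/eqP->; rewrite eC //.
  rewrite -[in X in e _ X](ys_last nh cX cXC xX pp lp up sp).
  exact: (e_xs_ys nh cX cXC xX pp up sp n1).
Qed.

Lemma degree_sum_structure : (0 < n)%N ->
  (exists S T, [/\ isolated_block X e S T, #|S| + #|T| = n, (0 < #|S|)%N & (0 < #|T|)%N]) \/
  (n = 4 /\ exists ts bs, gamma2_labelling X e ts bs).
Proof.
move=> n0; have [eC bX nh hp] := sat.
have [x [y [xX yX nxy]]] := exists_nonadjacent eC nh cX cXC n0.
have [p [pp lp up sp]] := hp _ _ xX yX nxy.
have [/existsP[j /and3P[jn nI I']]|nogap] :=
  boolP [exists j : 'I_n, [&& j.+1 < n, ~~ e x (ys x p j) & e x (ys x p j.+1)]].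
  by right; exact: ham_path_gap xX yX nxy pp lp up sp jn nI I'.
left.
have down i j : (j <= i)%N -> (i < n)%N -> e x (ys x p i) -> e x (ys x p j).
  elim: i => [|i IH]; first by rewrite leqn0 => /eqP->.
  rewrite leq_eqVlt ltnS => /orP[/eqP-> //|ji] lti Ii; apply: IH => //; first exact: ltnW.
  apply: contraR nogap => nIi; apply/existsP; exists (Ordinal (ltnW lti)) => /=.
  by rewrite lti nIi.
pose S := [set v in X | ~~ e v y]; pose T := [set w in ~: X | ~~ e x w].
(* By complementarity [v] is some [xs i] with [ys i] seen by [x], and [w] is some [ys j] missed by
   [x]. Without a gap i < j, and [y] sees [xs j], so an edge from [v] to [w] would be a double
   crossing. *)
have nST v w : v \in S -> w \in T -> ~~ e v w.
  rewrite !inE => /andP[vX nvy] /andP[wX nxw].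
  have [i iE] := xs_surj bX nh cX cXC xX pp up sp vX.
  have [j jE] := ys_surj bX nh cX cXC xX pp up sp wX.
  move: nvy nxw; rewrite iE jE (ham_path_complementary i xX yX nxy pp lp up sp) negbK => Ii nIj.
  have ij : (i < j)%N.
    by rewrite ltnNge; apply: contra nIj => ji; apply: (down i j ji) => //.
  apply: (ham_path_no_double_crossing eC nh cX cXC pp lp up sp ij) => //.
  by rewrite (ham_path_complementary j xX yX nxy pp lp up sp).
have xy := dsum xX yX nxy.
exists S, T; split.
- split.
  + by apply/subsetP => v; rewrite inE => /andP[].
  + by apply/subsetP => v; rewrite inE => /andP[].
  + move=> v w vS wX; have [vX nvy] : v \in X /\ ~~ e v y by apply/andP; move: vS; rewrite inE.
    (* A vertex of [S] sees nothing in [T], hence nothing that [x] misses; equal degrees turn the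
       inclusion of neighbourhoods into equality. *)
    have sub : [set u | e v u] \subset [set u | e x u].
      apply/subsetP => u; rewrite !inE => vu; apply: contraLR vu => nxu.
      have [uX|uX] := boolP (u \in X).
        by apply/negP => /bX; rewrite vX uX.
      by apply: nST => //; rewrite !inE uX.
    have dv : deg e v = deg e x by have := dsum vX yX nvy; move: xy; clear; lia.
    have /setP/(_ w) : [set u | e v u] = [set u | e x u].
      by apply/eqP; rewrite eqEcard sub -/(deg e v) -/(deg e x) dv leqnn.
    by rewrite !inE wX /= negbK.
  + move=> v w vX wT; have [wX nxw] : w \notin X /\ ~~ e x w.
      by apply/andP; move: wT; rewrite !inE.
    have sub : [set u | e w u] \subset [set u | e y u].
      apply/subsetP => u; rewrite !inE => wu; apply: contraLR wu => nyu.
      have [uX|uX] := boolP (u \in X); last first.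
        by apply/negP => /bX; rewrite (negbTE wX) (negbTE uX).
      by rewrite eC; apply: nST => //; rewrite !inE uX eC.
    have dv : deg e w = deg e y by have := dsum xX wX nxw; move: xy; clear; lia.
    have /setP/(_ v) : [set u | e w u] = [set u | e y u].
      by apply/eqP; rewrite eqEcard sub -/(deg e w) -/(deg e y) dv leqnn.
    by rewrite !inE vX /= negbK eC [e y v]eC.
- have -> : #|S| = deg e x.
    apply/eqP; rewrite -(eqn_add2r (deg e y)) xy -cX (deg_bipartiteC bX eC yX) addnC.
    rewrite -(cardsID [set v | e v y] X); apply/eqP.
    by congr (_ + _)%N; apply: eq_card => u; rewrite !inE // andbC.
  have -> : #|T| = deg e y.
    apply/eqP; rewrite -(eqn_add2l (deg e x)) xy -cXC (deg_bipartite bX xX).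
    rewrite -(cardsID [set v | e x v] (~: X)); apply/eqP.
    by congr (_ + _)%N; apply: eq_card => u; rewrite !inE // andbC.
  by [].
- by apply/card_gt0P; exists x; rewrite inE xX.
- by apply/card_gt0P; exists y; rewrite !inE yX.
Qed.

End DegreeSumN.

(** * Recognition of the extremal graphs *)

Section GraphStructure.
Variable G : sgraph.
Implicit Types X S T : {set G}.

Lemma min_degree_le (x : G) : (min_degree G <= degree x)%N.
Proof.
suff le (s : seq G) : x \in s -> (\big[minn/#|G|]_(y <- s) degree y <= degree x)%N.
  exact: le (mem_index_enum x).
elim: s => // y s IH; rewrite inE big_cons => /orP[/eqP->|/IH le].
  exact: geq_minl.
exact: leq_trans (geq_minr _ _) le.
Qed.

Lemma hamcyc_hamiltonian : (2 < #|G|)%N -> hamcyc (@edge G) -> hamiltonian G.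
Proof.
move=> G2 /hamcycP[c [cc uc sc]]; exists c; split=> //; first by rewrite sc.
have /subset_cardP/(_ (subset_predT _)) h : #|c| = #|G| by rewrite -sc; exact/card_uniqP.
by move=> x; rewrite h.
Qed.

Lemma isomorphic_of_inverse (H : sgraph) (g : H -> G) : bijective g ->
  (forall u v, edge (g u) (g v) = edge u v) -> isomorphic G H.
Proof.
case=> f gK fK gE; exists f; split; first by exists g.
by move=> x y; rewrite -gE !fK.
Qed.

Lemma enum_with_prefix X S n m : S \subset X -> #|X| = n -> #|S| = m ->
  exists h : 'I_n -> G, [/\ injective h, forall i, h i \in X & forall i, (h i \in S) = (i < m)%N].
Proof.
move=> SX cX cS; have [n0|n0] := posnP n.
  have f (i : 'I_n) : False by have := ltn_ord i; rewrite {2}n0.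
  by exists (fun i => False_rect _ (f i)); split=> i; case: (f i).
have [v0 v0X] : exists v, v \in X by apply/card_gt0P; rewrite cX.
pose s := enum S ++ enum (X :\: S).
have szs : size s = n.
  by rewrite size_cat -!cardE cardsD (setIidPr SX) subnKC ?subset_leq_card.
have us : uniq s.
  by rewrite cat_uniq !enum_uniq andbT /=; apply/hasPn => z; rewrite !mem_enum inE => /andP[].
exists (fun i => nth v0 s i); split.
- by move=> i j /eqP; rewrite nth_uniq ?szs // => /eqP/val_inj.
- move=> i; have : nth v0 s i \in s by rewrite mem_nth ?szs.
  by rewrite mem_cat !mem_enum inE => /orP[/(subsetP SX)//|/andP[]].
- move=> i; rewrite nth_cat -cardE cS; case: ltnP => im.
    by rewrite -mem_enum mem_nth // -cardE cS.
  apply/negbTE; have : nth v0 (enum (X :\: S)) (i - m) \in enum (X :\: S).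
    by rewrite mem_nth // -cardE cardsD (setIidPr SX) cX cS ltn_sub2r // (leq_ltn_trans im).
  by rewrite mem_enum inE => /andP[].
Qed.

Lemma two_sided_bij X n (ht hb : 'I_n -> G) : #|X| = n -> #|~: X| = n ->
  injective ht -> injective hb -> (forall i, ht i \in X) -> (forall i, hb i \notin X) ->
  bijective (fun u : 'I_n + 'I_n => match u with inl i => ht i | inr j => hb j end).
Proof.
move=> cX cXC ti bi tX bX; apply: inj_card_bij; last first.
  by rewrite card_sum card_ord -{1}cX -cXC cardsC.
move=> [i|j] [i'|j'] /=; [by move/ti->| | |by move/bi->].
- by move=> h; have := tX i; rewrite h (negbTE (bX _)).
- by move=> h; have := tX i'; rewrite -h (negbTE (bX _)).
Qed.

Lemma bipartite_rel_same_side X (e : rel G) x y : bipartite_rel X e ->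
  (x \in X) = (y \in X) -> e x y = false.
Proof. by move=> bX xy; apply/negP => /bX; rewrite xy eqxx. Qed.

(** The deleted block of [Bnk_rel] has its [n - k] vertices on the left, so the left copy is sent to
    [~: X], the side of [T]. *)
Lemma block_complement_Bnk X e S T n k : symmetric e -> bipartite_rel X e ->
  #|X| = n -> #|~: X| = n -> block_complement X e S T -> #|S| = k -> #|T| = (n - k)%N ->
  exists g : Bnk n k -> G, bijective g /\ forall u v, e (g u) (g v) = edge u v.
Proof.
move=> eC bX cX cXC [SX TX eE] cS cT.
have [hb [bi bXm bS]] := enum_with_prefix SX cX cS.
have [ht [ti tXm tT]] := enum_with_prefix TX cXC cT.
have cXCC : #|~: ~: X| = n by rewrite setCK.
have bXm' i : hb i \notin ~: X by rewrite inE bXm.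
have tXm' i : ht i \notin X by have := tXm i; rewrite inE.
exists (fun u : 'I_n + 'I_n => match u with inl i => ht i | inr j => hb j end).
split; first exact: two_sided_bij cXC cXCC ti bi tXm bXm'.
have er i j : e (hb i) (ht j) = Bnk_rel k j i by rewrite eE // bS tT /Bnk_rel andbC.
case=> [i|i] [j|j] //=.
- by apply: bipartite_rel_same_side bX _; rewrite !(negbTE (tXm' _)).
- by rewrite eC er.
- by apply: bipartite_rel_same_side bX _; rewrite !bXm.
Qed.

Lemma isolated_blockC X e S T : symmetric e -> isolated_block X e S T ->
  isolated_block (~: X) e T S.
Proof.
move=> eC [SX TX h1 h2]; split; rewrite ?setCK //.
  by move=> x y xT; rewrite inE negbK eC => yX; rewrite h2.
by move=> x y; rewrite inE eC => xX yS; rewrite h1.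
Qed.

(** [H] is induced on the vertices outside [S] and [T], with [X0] the rest of X. The [k] vertices of
    [T] see exactly [X0] and the [n - k] vertices of [S] exactly the rest of the other side, so
    these are the added vertices. *)
Lemma isolated_block_calB X S T n k : bipartition X -> #|X| = n -> #|~: X| = n ->
  isolated_block X (@edge G) S T -> (k <= n)%N -> #|S| = (n - k)%N -> #|T| = k -> calB n k G.
Proof.
move=> bX cX cXC [SX TX hS hT] kn cS cT.
pose P := [pred x : G | (x \notin S) && (x \notin T)].
pose E : rel {x | P x} := fun u v => edge (val u) (val v).
have EC : symmetric E by move=> u v; exact: edge_sym.
have EI : irreflexive E by move=> u; exact: edge_irr.
pose H := SGraph EC EI; pose X0 : {set H} := [set u : {x | P x} | val u \in X].
have TXn v : v \in T -> v \notin X by move/(subsetP TX); rewrite inE.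
have SXn v : v \in S -> v \in X by move/(subsetP SX).
have cX0 : #|X0| = k.
  have -> : k = #|X :\: S| by rewrite cardsD (setIidPr SX) cX cS subKn.
  rewrite -(card_imset _ val_inj) /=; apply: eq_card => v; apply/imsetP/idP.
    by case=> u; rewrite inE => uX ->; rewrite inE uX andbT; have /andP[] := valP u.
  rewrite inE => /andP[vS vX]; have Pv : P v.
    by rewrite /= vS; apply: contraTN vX => /TXn.
  by exists (exist _ v Pv); rewrite ?inE.
have cX0C : #|~: X0| = (n - k)%N.
  have -> : (n - k = #|~: X :\: T|)%N by rewrite cardsD (setIidPr TX) cXC cT.
  rewrite -(card_imset _ val_inj) /=; apply: eq_card => v; apply/imsetP/idP.
    by case=> u; rewrite !inE => uX ->; rewrite uX andbT; have /andP[] := valP u.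
  rewrite !inE => /andP[vT vX]; have Pv : P v.
    by rewrite /= vT andbT; apply: contraNN vX => /SXn.
  by exists (exist _ v Pv); rewrite ?inE.
exists H, X0; split=> //; first by move=> u v uv; rewrite !inE; exact: bX uv.
have [ht [ti tT _]] := enum_with_prefix (subxx T) cT cT.
have [hs [si sS _]] := enum_with_prefix (subxx S) cS cS.
pose g (u : attach X0 k (n - k)) : G := match u with
  inl h => val h | inr (inl i) => ht i | inr (inr j) => hs j end.
have nSv (u : H) : val u \notin S by have /andP[] := valP u.
have nTv (u : H) : val u \notin T by have /andP[] := valP u.
have gi : injective g.
  case=> [u|[i|j]] [u'|[i'|j']] //= h.
  - by congr inl; exact: val_inj.
  - by have := nTv u; rewrite /= h tT.
  - by have := nSv u; rewrite /= h sS.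
  - by have := nTv u'; rewrite /= -h tT.
  - by rewrite (ti _ _ h).
  - by have := TXn _ (tT i); rewrite h (SXn _ (sS j')).
  - by have := nSv u'; rewrite /= -h sS.
  - by have := TXn _ (tT i'); rewrite -h (SXn _ (sS j)).
  - by rewrite (si _ _ h).
apply: (isomorphic_of_inverse (g := g)).
  apply: inj_card_bij => //; rewrite -(cardsC X) cX cXC !card_sum !card_ord.
  by rewrite -[X in (_ <= X + _)%N](cardsC X0) cX0 cX0C; move: kn; clear; lia.
have same x y : (x \in X) = (y \in X) -> edge x y = false.
  exact: bipartite_rel_same_side.
case=> [u|[i|j]] [u'|[i'|j']] //=; rewrite ?inE.
- have [uX|uX] := boolP (val u \in X); first by rewrite hT // nSv.
  by apply: same; rewrite (negbTE uX) (negbTE (TXn _ (tT _))).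
- have [uX|uX] := boolP (val u \in X).
    by apply: same; rewrite uX SXn.
  by rewrite edge_sym hS // nTv.
- have [uX|uX] := boolP (val u' \in X); first by rewrite edge_sym hT // nSv.
  by apply: same; rewrite (negbTE uX) (negbTE (TXn _ (tT _))).
- by apply: same; rewrite !(negbTE (TXn _ (tT _))).
- by rewrite edge_sym hT ?SXn // sS.
- have [uX|uX] := boolP (val u' \in X).
    by apply: same; rewrite uX SXn.
  by rewrite hS // nTv.
- by rewrite hT ?SXn // sS.
- by apply: same; rewrite !SXn.
Qed.

(** The graph is determined except at the pair of hubs, and the edge between them distinguishes the
    two outcomes. *)
Lemma gamma_isomorphic X e (ts bs : 'I_4 -> G) : bipartition X ->
  #|X| = 4 -> #|~: X| = 4 -> gamma2_labelling X e ts bs ->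
  (forall i j, (i != ord0) || (j != ord0) -> edge (ts i) (bs j) = e (ts i) (bs j)) ->
  isomorphic G Gamma1 \/ isomorphic G Gamma2.
Proof.
move=> bX cX cXC [ti bi tX nbX eE] h.
have gb := two_sided_bij cX cXC ti bi tX nbX.
have same x y : (x \in X) = (y \in X) -> edge x y = false.
  exact: bipartite_rel_same_side.
have [e00|e00] := boolP (edge (ts ord0) (bs ord0)); [right|left].
- apply: (@isomorphic_of_inverse Gamma2 _ gb); have er i j : edge (ts i) (bs j) = Gamma2_rel i j.
    have [ij|] := boolP ((i != ord0) || (j != ord0)); first by rewrite h // eE.
    by rewrite negb_or !negbK => /andP[/eqP-> /eqP->]; rewrite e00.
  case=> [i|i] [j|j] //=; first by apply: same; rewrite !tX.
    by rewrite edge_sym er.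
  by apply: same; rewrite !(negbTE (nbX _)).
- apply: (@isomorphic_of_inverse Gamma1 _ gb); have er i j : edge (ts i) (bs j) = Gamma1_rel i j.
    rewrite /Gamma1_rel.
    have [ij|] := boolP ((i != ord0) || (j != ord0)).
      by rewrite h // eE /Gamma2_rel; move: ij; rewrite -negb_and => ->; rewrite andbT.
    by rewrite negb_or !negbK => /andP[/eqP-> /eqP->]; rewrite (negbTE e00) eqxx andbF.
  case=> [i|i] [j|j] //=; first by apply: same; rewrite !tX.
    by rewrite edge_sym er.
  by apply: same; rewrite !(negbTE (nbX _)).
Qed.

End GraphStructure.

From mathcomp Require Import classical_sets reals.
From mathcomp Require topology normedtype derive.

Local Open Scope ring_scope.

(** * Largest eigenvalues *)

Section WeightedForms.
Variables (R : realType) (V : finType).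
Implicit Types (w : V -> V -> R) (f g : V -> R).

(** Matrices indexed by V are kept as functions of two vertices, which spares the enumeration of V;
    [weight_mx] links them to matrices. *)
Definition qform w f : R := \sum_x \sum_y w x y * f x * f y.

Definition wapply w f : V -> R := fun x => \sum_y w x y * f y.

Definition eigenfun w (a : R) f : Prop :=
  (exists x, f x != 0) /\ forall x, wapply w f x = a * f x.

Lemma qform_wapply w f : qform w f = \sum_x f x * wapply w f x.
Proof.
apply: eq_bigr => x _; rewrite /wapply big_distrr /=.
by apply: eq_bigr => y _; ring.
Qed.

Lemma qformD w f g t : (forall x y, w x y = w y x) ->
  qform w (fun x => f x + t * g x) =
  qform w f + 2 * t * (\sum_x g x * wapply w f x) + t ^+ 2 * qform w g.
Proof.
move=> wC.
have E : \sum_x g x * wapply w f x = \sum_x \sum_y w x y * f x * g y.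
  rewrite exchange_big /=; apply: eq_bigr => x _; rewrite /wapply big_distrr /=.
  by apply: eq_bigr => y _; rewrite (wC x); ring.
have E' : \sum_x g x * wapply w f x = \sum_x \sum_y w x y * g x * f y.
  apply: eq_bigr => x _; rewrite /wapply big_distrr /=.
  by apply: eq_bigr => y _; ring.
have -> : 2 * t * (\sum_x g x * wapply w f x) =
    t * (\sum_x \sum_y w x y * f x * g y) + t * (\sum_x \sum_y w x y * g x * f y).
  by rewrite -E -E'; ring.
rewrite /qform !big_distrr /= -!big_split /=; apply: eq_bigr => x _.
rewrite !big_distrr /= -!big_split /=; apply: eq_bigr => y _.
by ring.
Qed.

Lemma psd_kernel w f : (forall x y, w x y = w y x) ->
  (forall g, 0 <= qform w g) -> qform w f = 0 -> forall x, wapply w f x = 0.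
Proof.
move=> wC psd f0 x.
set g := wapply w f; pose s := \sum_x g x * g x; pose r := qform w g.
have s_ge0 : 0 <= s by apply: sumr_ge0 => y _; rewrite -expr2 sqr_ge0.
have r_ge0 : 0 <= r := psd g.
suff : s == 0.
  rewrite psumr_eq0 => [|y _]; last by rewrite -expr2 sqr_ge0.
  by move/allP/(_ x (mem_index_enum _)); rewrite /= mulf_eq0 orbb => /eqP.
(* The form at f - tg is -2ts + t^2 r. The choice t = s/(r+1) makes it negative unless s = 0; the
   added 1 keeps the denominator positive. *)
have := psd (fun x => f x + - (s / (r + 1)) * g x).
rewrite qformD // f0 -/g -/s -/r.
have r1 : r + 1 != 0 by rewrite gt_eqF // ltr_wpDl.
have -> : 0 + 2 * - (s / (r + 1)) * s + (- (s / (r + 1))) ^+ 2 * r =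
   - (s ^+ 2 * ((r + 2) / (r + 1) ^+ 2)) by field.
rewrite oppr_ge0 pmulr_lle0.
  by move=> h; rewrite -sqrf_eq0 eq_le h sqr_ge0.
by rewrite divr_gt0 // ?exprn_gt0 // ?ltr_wpDl.
Qed.

End WeightedForms.

Import topology normedtype derive numFieldNormedType.Exports.

(** * The Rayleigh principle *)

Section Rayleigh.
Variables (R : realType) (V : finType).
Implicit Types (w : V -> V -> R) (f g : V -> R).

Local Open Scope classical_set_scope.

Lemma continuous_bigsum (n : nat) (I : Type) (r : seq I) (F : I -> 'rV[R]_n -> R) :
  (forall i, continuous (F i)) -> continuous (fun v => \sum_(i <- r) F i v).
Proof.
move=> cF; elim: r => [|i r IH] v.
  by under boolp.eq_fun do rewrite big_nil; exact: cst_continuous.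
under boolp.eq_fun do rewrite big_cons.
by apply: continuousD; [exact: cF|exact: IH].
Qed.

(** The Euclidean unit sphere is closed and, in the sup norm that row vectors carry, bounded by 1;
    so it is compact. *)
Lemma qform_sphere_max w : (0 < #|V|)%N ->
  exists2 f : V -> R, \sum_x f x ^+ 2 = 1 &
    forall g, \sum_x g x ^+ 2 = 1 -> qform w g <= qform w f.
Proof.
move=> V0.
pose ofv (v : 'rV[R]_#|V|) : V -> R := fun x => v ord0 (enum_rank x).
pose tov (f : V -> R) : 'rV[R]_#|V| := \row_i f (enum_val i).
have tovK f : ofv (tov f) =1 f by move=> x; rewrite /ofv mxE enum_rankK.
have cof x : continuous (fun v => ofv v x) by exact: coord_continuous.
pose nrm (v : 'rV[R]_#|V|) : R := \sum_x ofv v x ^+ 2.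
have cn : continuous nrm.
  apply: continuous_bigsum => x v; under boolp.eq_fun do rewrite expr2.
  by apply: continuousM; exact: cof.
have cq : continuous (fun v => qform w (ofv v)).
  apply: continuous_bigsum => x; apply: continuous_bigsum => y v.
  apply: (@continuousM _ _ (fun v => w x y * ofv v x) (fun v => ofv v y)); last exact: cof.
  by apply: (@continuousM _ _ (fun=> w x y) (fun v => ofv v x)); [exact: cst_continuous|exact: cof].
pose A := nrm @^-1` [set x | x = 1].
have A0 : A !=set0.
  move/card_gt0P: V0 => [x0 _]; exists (tov (fun x => (x == x0)%:R)).
  rewrite /A /= /nrm (bigD1 x0) //= tovK eqxx expr1n big1 ?addr0 // => x /negbTE nx.
  by rewrite tovK nx expr0n.
have Acl : closed A by apply: closed_comp => [? _|]; [exact: cn|exact: closed_eq].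
have Abd : bounded_set A.
  exists 1; split=> [|M M1 v vA]; first exact: num_real.
  apply: (le_trans _ (ltW M1)).
  rewrite [leLHS]/Num.Def.normr /= mx_normrE; apply/bigmax_leP; split=> // -[i j] _ /=.
  rewrite -(@expr_le1 _ 2) ?normr_ge0 //.
  rewrite -[leRHS]vA /nrm (bigD1 (enum_val j)) //= /ofv enum_valK real_normK ?num_real //.
  by rewrite (ord1 i) lerDl; apply: sumr_ge0 => y _; exact: sqr_ge0.
have [c cA cmax] := EVT_max_rV A0 (bounded_closed_compact Abd Acl)
   (continuous_subspaceT cq).
exists (ofv c); first by move/set_mem: cA.
move=> g g1; have e : ofv (tov g) = g by apply/boolp.funext => x; exact: tovK.
by rewrite -{1}e; apply: cmax; apply/mem_set; rewrite /A /= /nrm e.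
Qed.

Lemma sum_sqr_eq0 f : \sum_x f x ^+ 2 = 0 -> forall x, f x = 0.
Proof.
move/eqP; rewrite psumr_eq0 => [|y _]; last exact: sqr_ge0.
by move=> /allP h x; apply/eqP; have := h x (mem_index_enum _); rewrite /= sqrf_eq0.
Qed.

(** The equality case of the Rayleigh bound: [psd_kernel] for the weights of aI - w. *)
Lemma rayleigh_kernel w (a : R) f : (forall x y, w x y = w y x) ->
  (forall g, qform w g <= a * \sum_x g x ^+ 2) ->
  a * \sum_x f x ^+ 2 <= qform w f -> forall x, wapply w f x = a * f x.
Proof.
move=> wC wle fge x.
pose m x y := a * (x == y)%:R - w x y.
have mE g y : wapply m g y = a * g y - wapply w g y.
  rewrite /wapply; under eq_bigr do rewrite mulrBl.
  rewrite sumrB; congr (_ - _); rewrite (bigD1 y) //= eqxx mulr1.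
  by rewrite big1 ?addr0 // => z /negbTE; rewrite eq_sym => ->; rewrite mulr0 mul0r.
have mq g : qform m g = a * \sum_x g x ^+ 2 - qform w g.
  rewrite !qform_wapply big_distrr -sumrB; apply: eq_bigr => y _.
  by rewrite mE /=; ring.
have mC u y : m u y = m y u by rewrite /m wC eq_sym.
have mpsd g : 0 <= qform m g by rewrite mq subr_ge0.
have m0 : qform m f = 0 by apply/eqP; rewrite eq_le mpsd mq subr_le0 fge.
by have := psd_kernel mC mpsd m0 x; rewrite mE => /eqP; rewrite subr_eq0 => /eqP.
Qed.

Lemma rayleigh w : (0 < #|V|)%N -> (forall x y, w x y = w y x) ->
  exists a f, eigenfun w a f /\ forall g, qform w g <= a * \sum_x g x ^+ 2.
Proof.
move=> V0 wC; have [f f1 fmax] := qform_sphere_max w V0.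
have wle g : qform w g <= qform w f * \sum_x g x ^+ 2.
  have [/sum_sqr_eq0 g0|/eqP N0] := eqVneq (\sum_x g x ^+ 2) 0.
    rewrite !big1 ?mulr0 // => [|x _]; last by rewrite g0 expr0n.
    by rewrite qform_wapply big1 // => x _; rewrite g0 mul0r.
  set N := \sum_x _ in N0 *.
  have N_gt0 : 0 < N.
    by rewrite lt_def; apply/andP; split; [exact/eqP|apply: sumr_ge0 => x _; exact: sqr_ge0].
  pose h x := g x / Num.sqrt N.
  have h2 x y : h x * h y = g x * g y / N.
    by rewrite /h mulrACA -invfM -expr2 sqr_sqrtr // ltW.
  have := fmax h; have -> : qform w h = qform w g / N.
    rewrite /qform big_distrl; apply: eq_bigr => x _; rewrite big_distrl.
    by apply: eq_bigr => y _; rewrite -mulrA h2 /= !mulrA.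
  rewrite ler_pdivrMr //; apply.
  under eq_bigr => x _ do rewrite expr2 h2 -expr2; rewrite -big_distrl /= divff //; exact/eqP.
exists (qform w f), f; split=> //; split; last first.
  by apply: rayleigh_kernel => //; rewrite f1 mulr1.
apply/existsP; rewrite -negb_forall; apply/forallP => f0.
have : (0 : R) = 1 by rewrite -f1 big1 // => x _; rewrite (eqP (f0 x)) expr0n.
by move/eqP; rewrite eq_sym oner_eq0.
Qed.

End Rayleigh.

Section LargestEigenvalue.
Variables (R : realType) (V : finType).
Implicit Types (w : V -> V -> R) (f g : V -> R).

Definition weight_mx w : 'M[R]_#|V| := \matrix_(i, j) w (enum_val i) (enum_val j).

Lemma sum_enum_val (F : V -> R) : \sum_(i < #|V|) F (enum_val i) = \sum_x F x.
Proof. by rewrite -(big_enum_val F). Qed.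

Lemma eigenvalue_weight_mx w a : (forall x y, w x y = w y x) ->
  eigenvalue (weight_mx w) a <-> exists f, eigenfun w a f.
Proof.
move=> wC; split=> [/eigenvalueP[v vE v0]|[f [[x0 fx0] fE]]].
  exists (fun x => v ord0 (enum_rank x)); split.
    move/rV0Pn: v0 => [j vj]; exists (enum_val j); by rewrite enum_valK.
  move=> x; have := congr1 (fun u : 'rV_#|V| => u ord0 (enum_rank x)) vE.
  rewrite !mxE => <-; rewrite /wapply -sum_enum_val; apply: eq_bigr => i _.
  by rewrite mxE enum_valK enum_rankK wC mulrC.
apply/eigenvalueP; exists (\row_i f (enum_val i)).
  apply/rowP => j; rewrite !mxE -fE /wapply -sum_enum_val; apply: eq_bigr => i _.
  by rewrite !mxE wC mulrC.
by apply/rV0Pn; exists (enum_rank x0); rewrite mxE enum_rankK.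
Qed.

Definition max_eigenvalue w : R := largest_eigenvalue (weight_mx w).

(** Every eigenvalue is a Rayleigh quotient, so it is at most the Rayleigh maximum, which is itself
    an eigenvalue. The supremum in [largest_eigenvalue] is therefore attained. *)
Lemma max_eigenvalueP w : (0 < #|V|)%N -> (forall x y, w x y = w y x) ->
  (exists f, eigenfun w (max_eigenvalue w) f) /\
  forall g, qform w g <= max_eigenvalue w * \sum_x g x ^+ 2.
Proof.
move=> V0 wC; have [a [f [aP qle]]] := rayleigh V0 wC.
suff -> : max_eigenvalue w = a by split=> //; exists f.
have ub b : eigenvalue (weight_mx w) b -> b <= a.
  move=> /(eigenvalue_weight_mx _ wC)[g [[x gx] gE]].
  have := qle g; rewrite qform_wapply.
  have -> : \sum_y g y * wapply w g y = b * \sum_y g y ^+ 2.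
    by rewrite big_distrr; apply: eq_bigr => y _; rewrite gE /=; ring.
  rewrite ler_pM2r // lt_def sumr_ge0 ?andbT => [|y _]; last exact: sqr_ge0.
  by apply/eqP => /sum_sqr_eq0/(_ x)/eqP; rewrite (negbTE gx).
have ea : eigenvalue (weight_mx w) a by apply/eigenvalue_weight_mx => //; exists f.
apply/le_anti/andP; split.
  apply: sup_le_ub => [|b]; [by exists a|exact: ub].
by apply: sup_upper_bound => //; split; [exists a|exists a => b; exact: ub].
Qed.

End LargestEigenvalue.

(** * Nonnegative weights and Perron-Frobenius arguments *)

Section NonnegativeWeights.
Variables (R : realType) (V : finType).
Implicit Types (w : V -> V -> R) (f g z : V -> R).

Lemma eigenfun_le_max w a f : (0 < #|V|)%N -> (forall x y, w x y = w y x) ->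
  eigenfun w a f -> a <= max_eigenvalue w.
Proof.
move=> V0 wC [[x fx] fE]; have [_ /(_ f)] := max_eigenvalueP V0 wC.
rewrite qform_wapply; have -> : \sum_y f y * wapply w f y = a * \sum_y f y ^+ 2.
  by rewrite big_distrr; apply: eq_bigr => y _; rewrite fE /=; ring.
rewrite ler_pM2r // lt_def sumr_ge0 ?andbT => [|y _]; last exact: sqr_ge0.
by apply/eqP => /sum_sqr_eq0/(_ x)/eqP; rewrite (negbTE fx).
Qed.

Lemma eigenfun_norm_le w a f x : (forall x y, 0 <= w x y) -> eigenfun w a f ->
  `|a| * `|f x| <= wapply w (fun y => `|f y|) x.
Proof.
move=> w0 [_ fE]; rewrite -normrM -fE; apply: le_trans (ler_norm_sum _ _ _) _.
by apply: ler_sum => y _; rewrite normrM ger0_norm.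
Qed.

Lemma sum_mul_wapply w f g : (forall x y, w x y = w y x) ->
  \sum_x f x * wapply w g x = \sum_x g x * wapply w f x.
Proof.
move=> wC; rewrite /wapply; under eq_bigr do rewrite big_distrr.
rewrite exchange_big /=; apply: eq_bigr => x _; rewrite big_distrr /=.
by apply: eq_bigr => y _; rewrite wC; ring.
Qed.

(** A Collatz-Wielandt bound: pair |f| with the positive [z], move [w] across by symmetry, and
    cancel the positive sum of z|f|. *)
Lemma eigenfun_weighted_bound w a f z c : (forall x y, w x y = w y x) ->
  (forall x y, 0 <= w x y) -> (forall x, 0 < z x) ->
  (forall x, wapply w z x <= c * z x) -> eigenfun w a f -> `|a| <= c.
Proof.
move=> wC w0 z0 wz ef; have [[x0 fx0] _] := ef.
pose s := \sum_x z x * `|f x|.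
have s_gt0 : 0 < s.
  rewrite /s (bigD1 x0) //= ltr_pwDl ?mulr_gt0 ?normr_gt0 //.
  by apply: sumr_ge0 => x _; rewrite mulr_ge0 // ltW.
rewrite -(ler_pM2r s_gt0); apply: (@le_trans _ _ (\sum_x z x * wapply w (fun y => `|f y|) x)).
  rewrite big_distrr; apply: ler_sum => x _ /=; rewrite mulrCA.
  by rewrite ler_pM2l // eigenfun_norm_le.
rewrite sum_mul_wapply // big_distrr; apply: ler_sum => x _ /=.
by rewrite [leRHS]mulrA [leRHS]mulrC ler_wpM2l.
Qed.

(** If f is an eigenfunction of [w1] for its largest eigenvalue, then |f| also maximizes the
    Rayleigh quotient of [w2], so it is an eigenfunction of [w2], positive by irreducibility. Both
    forms agree at |f|, which forces the entries to agree. Irreducibility is expressed by closed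
    predicates instead of paths. *)
Lemma max_eigenvalue_rigidity w1 w2 : (0 < #|V|)%N ->
  (forall x y, w1 x y = w1 y x) -> (forall x y, w2 x y = w2 y x) ->
  (forall x y, 0 <= w1 x y) -> (forall x y, w1 x y <= w2 x y) ->
  (forall P : pred V, (exists x, P x) ->
     (forall x y, P x -> 0 < w2 x y -> P y) -> forall x, P x) ->
  max_eigenvalue w2 <= max_eigenvalue w1 -> forall x y, w1 x y = w2 x y.
Proof.
move=> V0 C1 C2 w1_ge0 w12 irr le21.
have [[f ef] _] := max_eigenvalueP V0 C1; have [_ q2] := max_eigenvalueP V0 C2.
set a := max_eigenvalue w1 in ef le21; set b := max_eigenvalue w2 in q2 le21.
pose g x := `|f x|; have g0 x : 0 <= g x := normr_ge0 _.
have N0 : 0 <= \sum_x g x ^+ 2 by apply: sumr_ge0 => x _; exact: sqr_ge0.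
have q12 : qform w1 g <= qform w2 g.
  by apply: ler_sum => x _; apply: ler_sum => y _; rewrite ler_wpM2r // ler_wpM2r.
have aq1 : a * \sum_x g x ^+ 2 <= qform w1 g.
  rewrite qform_wapply big_distrr; apply: ler_sum => x _ /=.
  rewrite expr2 mulrCA ler_wpM2l //; apply: le_trans (eigenfun_norm_le x w1_ge0 ef).
  by rewrite ler_wpM2r // ler_norm.
have bq2 : b * \sum_x g x ^+ 2 <= qform w2 g.
  by apply: le_trans (le_trans aq1 q12); rewrite ler_wpM2r.
have eq2 := rayleigh_kernel C2 q2 bq2.
have q21 : qform w2 g <= qform w1 g.
  by apply: le_trans (q2 g) (le_trans _ aq1); rewrite ler_wpM2r.
have g_gt0 x : 0 < g x.
  have : exists x, g x != 0 by have [[y fy] _] := ef; exists y; rewrite normr_eq0.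
  have [y gy0|gn0] := pickP [pred y | g y == 0]; last first.
    by rewrite lt_def g0 andbT => _; have /= -> := gn0 x.
  case=> y' /negP[]; move: y'; apply: irr; first by exists y.
  (* The eigenvalue equation at a zero of [g] is a vanishing sum of nonnegative terms, so the zero
     set is closed under neighbours. *)
  move=> u v /eqP gu uv; have /eqP := eq2 u; rewrite gu mulr0 psumr_eq0 => [|v' _].
    by move/allP/(_ v (mem_index_enum _)); rewrite /= mulf_eq0 gt_eqF.
  by rewrite mulr_ge0 // (le_trans (w1_ge0 _ _) (w12 _ _)).
move=> x y; apply/eqP; rewrite eq_le w12 /=.
have D_ge0 u v : 0 <= (w2 u v - w1 u v) * (g u * g v).
  by rewrite mulr_ge0 ?subr_ge0 // mulr_ge0.
have : \sum_u \sum_v (w2 u v - w1 u v) * (g u * g v) == 0.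
  rewrite eq_le; apply/andP; split; last first.
    by apply: sumr_ge0 => u _; apply: sumr_ge0.
  suff -> : \sum_u \sum_v (w2 u v - w1 u v) * (g u * g v) = qform w2 g - qform w1 g.
    by rewrite subr_le0.
  rewrite -sumrB; apply: eq_bigr => u _; rewrite -sumrB; apply: eq_bigr => v _; ring.
rewrite psumr_eq0 => [/allP/(_ x (mem_index_enum _))/=|u _]; last exact: sumr_ge0.
rewrite psumr_eq0 // => /allP/(_ y (mem_index_enum _))/=.
by rewrite mulf_eq0 [g x * _ == 0]gt_eqF ?mulr_gt0 // orbF subr_eq0 => /eqP ->.
Qed.

End NonnegativeWeights.

(** Since [z] may vanish at [x0], its Rayleigh quotient need not exceed [c]. Strictness comes from
    the equality case: if the maximum were at most [c], then [z] would satisfy the eigenvalue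
    equation for [c], also at [x0]. *)
Lemma lt_max_eigenvalue (R : realType) (V : finType) (w : V -> V -> R) (z : V -> R) c x0 :
  (forall x y, w x y = w y x) -> (forall x, 0 <= z x) ->
  (forall x, c * z x <= wapply w z x) -> c * z x0 < wapply w z x0 ->
  c < max_eigenvalue w.
Proof.
move=> wC z0 cz czx; rewrite ltNge; apply/negP => lec.
have V0 : (0 < #|V|)%N by apply/card_gt0P; exists x0.
have [_ qle] := max_eigenvalueP V0 wC.
suff e : wapply w z x0 = c * z x0 by rewrite e ltxx in czx.
apply: rayleigh_kernel => // [g|].
  by apply: le_trans (qle g) _; rewrite ler_wpM2r //; apply: sumr_ge0 => x _; exact: sqr_ge0.
rewrite qform_wapply big_distrr; apply: ler_sum => x _ /=.
by rewrite expr2 mulrCA ler_wpM2l.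
Qed.

Lemma max_eigenvalue_bij (R : realType) (V W : finType) (f : V -> W) (w : W -> W -> R) :
  (0 < #|V|)%N -> bijective f -> (forall x y, w x y = w y x) ->
  max_eigenvalue (fun x y => w (f x) (f y)) = max_eigenvalue w.
Proof.
move=> V0 [g fK gK] wC; have W0 : (0 < #|W|)%N.
  by rewrite -(bij_eq_card (Bijective fK gK)).
set w' := fun x y => _; have w'C x y : w' x y = w' y x by exact: wC.
have wf h x : wapply w' (h \o f) x = wapply w h (f x).
  by rewrite /wapply [RHS](reindex f) //; exists g => ? _.
apply/le_anti/andP; split.
  have [[h [[x hx] hE]] _] := max_eigenvalueP V0 w'C.
  apply: (eigenfun_le_max (f := h \o g)) => //; split.
    by exists (f x); rewrite /= fK.
  move=> y; rewrite -{1}(gK y) -wf /= -hE.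
  by apply: eq_bigr => u _; rewrite /= fK.
have [[h [[x hx] hE]] _] := max_eigenvalueP W0 wC.
apply: (eigenfun_le_max (f := h \o f)) => //; split.
  by exists (g x); rewrite /= gK.
by move=> y; rewrite wf hE.
Qed.

(** * Spectral bounds by degrees and edges *)

Section GraphWeights.
Variables (R : realType) (G : sgraph).

Definition adjw (x y : G) : R := (edge x y)%:R.
(** The entries of the signless Laplacian. *)
Definition slw (x y : G) : R := adjw x y + (x == y)%:R * (degree x)%:R.

Lemma adjw_sym x y : adjw x y = adjw y x.
Proof. by rewrite /adjw edge_sym. Qed.

Lemma slw_sym x y : slw x y = slw y x.
Proof. by rewrite /slw adjw_sym eq_sym; case: eqP => [->|]; rewrite ?mul0r. Qed.

Lemma adjw_ge0 x y : 0 <= adjw x y. Proof. exact: ler0n. Qed.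

Lemma slw_ge0 x y : 0 <= slw x y.
Proof. by rewrite addr_ge0 ?adjw_ge0 // mulr_ge0. Qed.

Lemma rhoE : rho R G = max_eigenvalue adjw.
Proof. by []. Qed.

Lemma qE : q R G = max_eigenvalue slw.
Proof.
rewrite /q /max_eigenvalue; congr largest_eigenvalue; apply/matrixP => i j.
rewrite !mxE /slw /adjw (inj_eq enum_val_inj); congr (_ + _).
by case: eqP => [->|_]; rewrite ?mul1r ?mulr1n ?mul0r ?mulr0n.
Qed.

Lemma degreeE (x : G) : degree x = (\sum_y (edge x y))%N.
Proof. exact: degE. Qed.

Lemma natr_degree (x : G) : (degree x)%:R = \sum_y adjw x y.
Proof. by rewrite degreeE natr_sum. Qed.

Lemma wapply_slw (f : G -> R) x :
  wapply slw f x = wapply adjw f x + (degree x)%:R * f x.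
Proof.
rewrite /wapply; under eq_bigr do rewrite mulrDl.
rewrite big_split /=; congr (_ + _); rewrite (bigD1 x) //= eqxx mul1r.
by rewrite big1 ?addr0 // => y /negbTE; rewrite eq_sym => ->; rewrite !mul0r.
Qed.

Lemma wapply_adjw_degree x :
  wapply adjw (fun y => (degree y)%:R) x = (\sum_(y | edge x y) degree y)%N%:R.
Proof.
rewrite natr_sum big_mkcond /=; apply: eq_bigr => y _; rewrite /adjw.
by case: ifP; rewrite ?mul1r ?mul0r.
Qed.

(** The sums of neighbour degrees are the row sums of the squared adjacency matrix, and
    [rho R G ^+ 2] is an eigenvalue of that square. *)
Lemma rho_sqr_le c : (0 < #|G|)%N ->
  (forall x : G, (\sum_(y | edge x y) degree y <= c)%N) -> rho R G ^+ 2 <= c%:R.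
Proof.
move=> G0 le_c; have [[f ef] _] := max_eigenvalueP G0 adjw_sym; rewrite rhoE.
set a := max_eigenvalue _ in ef *; have [f0 fE] := ef.
pose w2 x y : R := \sum_u adjw x u * adjw u y.
have w2E g x : wapply w2 g x = wapply adjw (wapply adjw g) x.
  rewrite /wapply; under eq_bigr do rewrite big_distrl.
  rewrite exchange_big /=; apply: eq_bigr => u _; rewrite big_distrr /=.
  by apply: eq_bigr => y _; rewrite mulrA.
have ef2 : eigenfun w2 (a ^+ 2) f.
  split=> // x; rewrite w2E; transitivity (wapply adjw (fun y => a * f y) x).
    by apply: eq_bigr => y _; rewrite fE.
  rewrite expr2 -mulrA -fE /wapply big_distrr /=.
  by apply: eq_bigr => y _; rewrite mulrCA.
rewrite -[leLHS]ger0_norm ?sqr_ge0 //.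
apply: (eigenfun_weighted_bound (z := fun=> 1) _ _ _ _ ef2) => // [x y|x y|x].
- by apply: eq_bigr => u _; rewrite adjw_sym mulrC adjw_sym.
- by apply: sumr_ge0 => u _; rewrite mulr_ge0 ?adjw_ge0.
rewrite w2E mulr1; have -> : wapply adjw (wapply adjw (fun=> 1)) x =
    wapply adjw (fun y => (degree y)%:R) x.
  apply: eq_bigr => y _; congr (_ * _); rewrite natr_degree.
  by apply: eq_bigr => u _; rewrite mulr1.
by rewrite wapply_adjw_degree ler_nat.
Qed.

Section Bipartite.
Variables (n : nat) (X : {set G}).
Hypothesis hX : balanced_bipartition n X.

Lemma handshake : (\sum_(x in X) degree x = \sum_(x in ~: X) degree x)%N.
Proof. by have [bX _ _] := hX; exact: sum_deg_bipartite (@edge_sym G) bX. Qed.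

(** The neighbours of a vertex all lie on one side, and the degrees on either side sum to the number
    of edges. *)
Lemma sum_nbr_degree_le (x : G) :
  (\sum_(y | edge x y) degree y <= \sum_(x in X) degree x)%N.
Proof.
have [bX _ _] := hX.
have sub (A : {set G}) : (forall y, edge x y -> y \in A) ->
    (\sum_(y | edge x y) degree y <= \sum_(y in A) degree y)%N.
  move=> sA; rewrite big_mkcond [leqRHS]big_mkcond /=; apply: leq_sum => y _.
  by case: ifP => // /sA ->.
have [xX|xX] := boolP (x \in X); last first.
  by apply: sub => y /bX; rewrite (negbTE xX); case: (y \in X).
by rewrite handshake; apply: sub => y /bX; rewrite xX inE; case: (y \in X).
Qed.

Lemma rho_sqr_le_edges : (0 < n)%N ->
  rho R G ^+ 2 <= (\sum_(x in X) degree x)%N%:R.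
Proof.
move=> n0; have [_ cX _] := hX.
apply: rho_sqr_le => [|x]; last exact: sum_nbr_degree_le.
by apply: leq_trans (max_card (mem X)); rewrite cX.
Qed.

Lemma degree_le (x : G) : (degree x <= n)%N.
Proof. by have [bX cX cX'] := hX; exact: deg_le_balanced bX cX cX'. Qed.

(** A weighted row-sum bound with the degree vector as the positive test vector. *)
Lemma q_le_edges : (0 < n)%N -> (forall x : G, 0 < degree x)%N ->
  q R G <= (\sum_(x in X) degree x)%N%:R / n%:R + n%:R.
Proof.
move=> n0 d0; have [_ cX _] := hX.
have G0 : (0 < #|G|)%N.
  by apply: leq_trans (max_card (mem X)); rewrite cX.
have [[f ef] _] := max_eigenvalueP G0 slw_sym; rewrite qE.
apply: le_trans (ler_norm _) _.
apply: (eigenfun_weighted_bound (z := fun x => (degree x)%:R) slw_sym slw_ge0 _ _ ef).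
  by move=> x; rewrite ltr0n.
move=> x; rewrite wapply_slw wapply_adjw_degree.
set e := (\sum_(x in X) _)%N; set s := (\sum_(y | _) _)%N; set d := degree x.
have se : s%:R <= e%:R :> R by rewrite ler_nat sum_nbr_degree_le.
have sd : s%:R <= d%:R * n%:R :> R.
  rewrite -natrM ler_nat; apply: (@leq_trans (\sum_(y | edge x y) n)).
    by apply: leq_sum => y _; exact: degree_le.
  by rewrite sum_nat_const leq_mul2r /d /degree cardsE leqnn orbT.
have dn : d%:R <= n%:R :> R by rewrite ler_nat degree_le.
have n0' : 0 < n%:R :> R by rewrite ltr0n.
have d0' : 0 < d%:R :> R by rewrite ltr0n d0.
have e_tn : e%:R = e%:R / n%:R * n%:R :> R by rewrite divfK // gt_eqF.
move: (e%:R / n%:R) e_tn => t e_tn; rewrite e_tn in se.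
(* With t = |E|/n, the claim s + d^2 <= (t + n)d follows from s <= dn if d <= t, and otherwise from
   s <= tn and (d - t)(n - d) >= 0. *)
by have [dt|td] := lerP (d%:R : R) t; nra.
Qed.

End Bipartite.
End GraphWeights.

(** * The spectra of B_n^k and of its quasi-complement *)

Section BnkSpectra.
Variables (R : realType) (n k : nat).
Hypotheses (k0 : (0 < k)%N) (kn : (k < n)%N).

Let p0 : (n.-1 < n)%N. Proof. by rewrite prednK // (leq_ltn_trans _ kn). Qed.
(** As k >= 1, the left vertex with this index lies outside the deleted block and sees the whole
    right side; as k < n, the right one sees the whole left side. They give strictness in the
    spectral bounds and connectedness. *)
Let last_ord : 'I_n := Ordinal p0.

Lemma Bnk_rel_lastl y : @Bnk_rel n k last_ord y.
Proof. by rewrite /Bnk_rel /= -[in X in ~~ X]ltnS; apply/negP => /andP[h _]; move: h; lia. Qed.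

Lemma Bnk_rel_highr x (y : 'I_n) : (k <= y)%N -> @Bnk_rel n k x y.
Proof. by rewrite /Bnk_rel leqNgt => /negbTE ->; rewrite andbF. Qed.

Lemma sum_ord_ge : (\sum_(i < n) (k <= i) = n - k)%N.
Proof.
rewrite -(big_mkord xpredT (fun i => (k <= i)%N : nat)).
elim: (n) => [|m IH]; first by rewrite big_geq.
by rewrite big_nat_recr //= IH; case: leqP => /=; lia.
Qed.

Lemma card_Bnk_gt0 : (0 < #|Bnk n k|)%N.
Proof. by rewrite card_sum card_ord addn_gt0 (leq_ltn_trans _ kn). Qed.

Lemma degree_Bnk_inl (x : 'I_n) : (n - k <= @degree (Bnk n k) (inl x))%N.
Proof.
rewrite degreeE big_sumType /= big1 ?add0n // -sum_ord_ge; apply: leq_sum => y _.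
by have [ky|//] := leqP k y; rewrite Bnk_rel_highr.
Qed.

Lemma degree_Bnk_inr (y : 'I_n) : (k <= y)%N -> @degree (Bnk n k) (inr y) = n.
Proof.
move=> ky; rewrite degreeE big_sumType /= [X in (_ + X)%N]big1 ?addn0 //.
under eq_bigr do rewrite Bnk_rel_highr //.
by rewrite sum1_card card_ord.
Qed.

(* With suitable a and b, the Perron vector of K_{n,n-k} extended by 0. *)
Definition Bnk_vector (a b : R) (v : Bnk n k) : R :=
  match v with inl _ => a | inr y => if (k <= y)%N then b else 0 end.

Lemma Bnk_vector_inl a b (x : 'I_n) :
  wapply (@adjw R (Bnk n k)) (Bnk_vector a b) (inl x) = (n - k)%:R * b.
Proof.
rewrite /wapply big_sumType /= big1 ?add0r => [|i _]; last by rewrite /adjw mul0r.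
rewrite -sum_ord_ge natr_sum big_distrl; apply: eq_bigr => y _ /=.
rewrite /adjw /=; case: leqP => [ky|_]; last by rewrite mulr0 mul0r.
by rewrite Bnk_rel_highr.
Qed.

Lemma Bnk_vector_inr a b (y : 'I_n) : (k <= y)%N ->
  wapply (@adjw R (Bnk n k)) (Bnk_vector a b) (inr y) = n%:R * a.
Proof.
move=> ky; rewrite /wapply big_sumType /= [X in _ + X]big1 ?addr0 => [|i _]; last first.
  by rewrite /adjw mul0r.
under eq_bigr do rewrite /adjw /= Bnk_rel_highr // mul1r.
by rewrite sumr_const mulr_natl card_ord.
Qed.

Lemma Bnk_vector_inr_gt0 a b (y : 'I_n) : 0 < a -> 0 <= b ->
  0 < wapply (@adjw R (Bnk n k)) (Bnk_vector a b) (inr y).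
Proof.
move=> a0 b0; rewrite /wapply (bigD1 (inl last_ord)) //= {1}/adjw /= Bnk_rel_lastl mul1r.
rewrite ltr_pwDl //; apply: sumr_ge0 => v _; rewrite mulr_ge0 ?adjw_ge0 //.
by case: v => [x|y'] /=; [exact: ltW|case: ifP].
Qed.

(** Strictness comes from a right vertex of index below [k]: the test vector vanishes there, but not
    at its neighbour [last_ord]. *)
Lemma rho_Bnk_gt : (n * (n - k))%:R < rho R (Bnk n k) ^+ 2.
Proof.
have m0 : 0 < (n - k)%:R :> R by rewrite ltr0n subn_gt0.
have n0 : 0 < n%:R :> R by rewrite ltr0n; lia.
rewrite natrM; set m : R := (n - k)%:R in m0 *; set N : R := n%:R in n0 *.
suff : Num.sqrt N * Num.sqrt m < rho R (Bnk n k).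
  move=> lt; have s0 : 0 <= Num.sqrt N * Num.sqrt m by rewrite mulr_ge0 ?sqrtr_ge0.
  rewrite -(sqr_sqrtr (ltW n0)) -(sqr_sqrtr (ltW m0)) -exprMn ltr_pXn2r //.
  by rewrite nnegrE (le_trans s0) // ltW.
have z0 : (0 < n)%N by lia.
rewrite rhoE; apply: (lt_max_eigenvalue (z := Bnk_vector (Num.sqrt m) (Num.sqrt N))
  (x0 := inr (Ordinal z0))).
- exact: adjw_sym.
- by case=> [x|y] /=; rewrite ?sqrtr_ge0 //; case: ifP; rewrite ?sqrtr_ge0.
- case=> [x|y].
    by rewrite Bnk_vector_inl /= -mulrA -expr2 sqr_sqrtr ?(ltW m0) // mulrC.
  have [ky|ky] := leqP k y.
    by rewrite Bnk_vector_inr // /= ky mulrAC -expr2 sqr_sqrtr ?(ltW n0).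
  rewrite /= leqNgt ky mulr0; apply/ltW/Bnk_vector_inr_gt0; rewrite ?sqrtr_gt0 ?sqrtr_ge0 //.
- rewrite /= leqNgt k0 mulr0.
  by apply: Bnk_vector_inr_gt0; rewrite ?sqrtr_gt0 ?sqrtr_ge0.
Qed.

(** The values n - k and n form the Perron vector of the signless Laplacian of K_{n,n-k}. Left
    degrees in B_n^k are at least n - k, so the inequality survives. *)
Lemma q_Bnk_gt : (n + (n - k))%:R < q R (Bnk n k).
Proof.
have m0 : 0 < (n - k)%:R :> R by rewrite ltr0n subn_gt0.
have n0 : 0 < n%:R :> R by rewrite ltr0n; lia.
have z0 : (0 < n)%N by lia.
rewrite qE; apply: (lt_max_eigenvalue (z := Bnk_vector (n - k)%:R n%:R)
  (x0 := inr (Ordinal z0))).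
- exact: slw_sym.
- by case=> [x|y] /=; rewrite ?ler0n //; case: ifP.
- case=> [x|y]; rewrite wapply_slw.
    rewrite Bnk_vector_inl /= natrD mulrDl [n%:R * _]mulrC lerD2l ler_wpM2r ?ler0n //.
    by rewrite ler_nat degree_Bnk_inl.
  have [ky|ky] := leqP k y.
    rewrite Bnk_vector_inr // degree_Bnk_inr //= ky natrD le_eqVlt.
    by apply/orP; left; apply/eqP; ring.
  rewrite /= leqNgt ky !mulr0 addr0; apply/ltW/Bnk_vector_inr_gt0; rewrite ?ler0n //.
- rewrite wapply_slw /= leqNgt k0 !mulr0 addr0.
  by apply: Bnk_vector_inr_gt0; rewrite ?ler0n.
Qed.

Lemma Bnk_irreducible (P : pred (Bnk n k)) : (exists x, P x) ->
  (forall x y, P x -> edge x y -> P y) -> forall x, P x.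
Proof.
move=> [v Pv] Pe.
have allr : P (inl last_ord) -> forall v', P v'.
  move=> Pl; have Pr y : P (inr y) by apply: Pe Pl _; exact: Bnk_rel_lastl.
  case=> // x; apply: Pe (Pr last_ord) _ => /=; rewrite Bnk_rel_highr //=; lia.
case: v Pv => [x|y] Pv; last by apply: allr; apply: Pe Pv _; exact: Bnk_rel_lastl.
apply: allr; apply: (Pe (inr last_ord)); last exact: Bnk_rel_lastl.
by apply: Pe Pv _; rewrite /= Bnk_rel_highr //=; lia.
Qed.

(** The quasi-complement is K_{n-k,k} with isolated vertices, so neighbour degrees sum to k(n-k) or
    to 0. *)
Lemma rho_Bnk_qcompl_le : rho R (Bnk_qcompl n k) ^+ 2 <= (k * (n - k))%:R.
Proof.
have cnt m : (m <= n)%N -> (\sum_(i < n) (i < m) = m)%N.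
  move=> mn; rewrite -(big_mkord xpredT (fun i => (i < m)%N : nat)).
  rewrite -[RHS](minn_idPr mn); elim: (n) => [|j IH]; first by rewrite big_geq // min0n.
  by rewrite big_nat_recr //= IH; case: (ltnP j m); lia.
have el x y : @edge (Bnk_qcompl n k) (inl x) (inr y) = (x < n - k)%N && (y < k)%N.
  by rewrite /= /qcompl_edge !inE /= negbK.
have er x y : @edge (Bnk_qcompl n k) (inr y) (inl x) = (x < n - k)%N && (y < k)%N.
  by rewrite /= /qcompl_edge !inE /= negbK.
have ell x y : @edge (Bnk_qcompl n k) (inl x) (inl y) = false.
  by rewrite /= /qcompl_edge !inE.
have err x y : @edge (Bnk_qcompl n k) (inr x) (inr y) = false.
  by rewrite /= /qcompl_edge !inE.
have split_sum (F : 'I_n + 'I_n -> nat) :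
    (\sum_v F v = \sum_i F (inl i) + \sum_i F (inr i))%N by exact: big_sumType.
have dl x : @degree (Bnk_qcompl n k) (inl x) = ((x < n - k) * k)%N.
  rewrite degreeE split_sum big1 => [|i _]; last by rewrite ell.
  rewrite add0n -[X in (_ = _ * X)%N](cnt k) ?(ltnW kn) // big_distrr; apply: eq_bigr => y _.
  by rewrite el -mulnb.
have dr y : @degree (Bnk_qcompl n k) (inr y) = ((y < k) * (n - k))%N.
  rewrite degreeE split_sum addnC big1 => [|i _]; last by rewrite err.
  rewrite add0n -[X in (_ = _ * X)%N](cnt (n - k)%N) ?leq_subr // big_distrr; apply: eq_bigr => x _.
  by rewrite er andbC -mulnb.
apply: rho_sqr_le => [|[x|y]]; first exact: card_Bnk_gt0.
- rewrite big_mkcond split_sum big1 => [|i _]; last by rewrite ell.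
  rewrite add0n -[X in (_ <= X * _)%N](cnt k) ?(ltnW kn) // big_distrl; apply: leq_sum => y _.
  by rewrite el dr; case: (x < n - k)%N; case: (y < k)%N.
- rewrite big_mkcond split_sum addnC big1 => [|i _]; last by rewrite err.
  rewrite add0n mulnC -[X in (_ <= X * _)%N](cnt (n - k)%N) ?leq_subr //.
  rewrite big_distrl; apply: leq_sum => x _.
  by rewrite er dl; case: (x < n - k)%N; case: (y < k)%N.
Qed.

End BnkSpectra.

Lemma leq_bool (b c : bool) : (b -> c) -> (b <= c)%N.
Proof. by case: b => // ->. Qed.

Lemma card_nonnbrs (V : finType) (Y : {set V}) (e : rel V) n v : bipartite_rel Y e ->
  #|Y| = n -> #|~: Y| = n ->
  (#|[set u | ((v \in Y) != (u \in Y)) && ~~ e v u]| + deg e v = n)%N.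
Proof.
move=> bY cY cYC; have side (Z : {set V}) : bipartite_rel Z e -> v \in Z -> #|~: Z| = n ->
    (#|[set u | (u \notin Z) && ~~ e v u]| + deg e v = n)%N.
  move=> bZ vZ <-; rewrite (deg_bipartite bZ vZ) addnC -(cardsID [set u | e v u] (~: Z)).
  by congr (_ + _)%N; apply: eq_card => u; rewrite !inE // andbC.
have [vY|vY] := boolP (v \in Y); first by rewrite -[RHS](side Y).
rewrite -[RHS](side (~: Y)) ?inE ?finset.setCK //; last exact: bipartite_relC.
by congr (_ + _)%N; apply: eq_card => u; rewrite !inE; case: (u \in Y).
Qed.

(** With dx = k+s, dy = k+t and n = dx+dy+r, the two sides differ by st + r(k+s+t+r). *)
Lemma codegree_product k n dx dy : (k <= dx)%N -> (k <= dy)%N -> (dx + dy <= n)%N ->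
  (k * (n - k) <= (n - dx) * (n - dy))%N.
Proof.
move=> kx ky xy.
have [s sE] : exists s, dx = (k + s)%N by exists (dx - k)%N; lia.
have [t tE] : exists t, dy = (k + t)%N by exists (dy - k)%N; lia.
have [r rE] : exists r, n = (dx + dy + r)%N by exists (n - (dx + dy))%N; lia.
have -> : (n - k = k + s + t + r)%N by lia.
have -> : (n - dx = k + t + r)%N by lia.
have -> : (n - dy = k + s + r)%N by lia.
clear; lia.
Qed.

(** The same difference is at least kr + st, so equality forces r = 0 and s = 0 or t = 0. *)
Lemma codegree_product_eq k n dx dy : (0 < k <= dx)%N -> (k <= dy)%N -> (dx + dy <= n)%N ->
  ((n - dx) * (n - dy) = k * (n - k))%N -> (dx + dy)%N = n /\ (dx = k \/ dx = n - k)%N.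
Proof.
move=> /andP[k0 kx] ky xy.
have [s sE] : exists s, dx = (k + s)%N by exists (dx - k)%N; lia.
have [t tE] : exists t, dy = (k + t)%N by exists (dy - k)%N; lia.
have [r rE] : exists r, n = (dx + dy + r)%N by exists (n - (dx + dy))%N; lia.
have -> : (n - k = k + s + t + r)%N by lia.
have -> : (n - dx = k + t + r)%N by lia.
have -> : (n - dy = k + s + r)%N by lia.
move=> eq; have /eqP : (k * r + s * t = 0)%N.
  suff : (k * r + s * t <= 0)%N by rewrite leqn0 => /eqP.
  by move: eq; clear; nia.
rewrite addn_eq0 !muln_eq0 gtn_eqF //= => /andP[/eqP r0 /orP[]/eqP z0]; lia.
Qed.

(** * Spectral conditions for Hamiltonicity *)

Section Hamiltonicity.
Variables (R : realType) (n k : nat) (G : sgraph) (X : {set G}).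
Hypotheses (hX : balanced_bipartition n X) (k0 : (0 < k)%N).
Hypothesis dk : forall x : G, (k <= degree x)%N.

Let bX : bipartite_rel X (@edge G). Proof. by case: hX. Qed.
Let cX : #|X| = n. Proof. by case: hX. Qed.
Let cXC : #|~: X| = n. Proof. by case: hX. Qed.
Let cG : #|G| = n.*2. Proof. by rewrite -(cardsC X) cX cXC addnn. Qed.

Lemma hamiltonian_or_saturated : (1 < n)%N ->
  hamiltonian G \/ exists2 e, ham_saturated X e & subrel (@edge G) e.
Proof.
move=> n1; have G2 : (2 < #|G|)%N by rewrite cG; move: n1; clear; lia.
have [/hamcyc_hamiltonian hG|nh] := boolP (hamcyc (@edge G)); first by left; exact: hG.
by right; exact: exists_ham_saturated (@edge_sym G) bX nh.
Qed.

Lemma subrel_deg (e : rel G) x : subrel (@edge G) e -> (degree x <= deg e x)%N.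
Proof. by move=> ee; apply: subset_leq_card; apply/fintype.subsetP => y; rewrite !inE => /ee. Qed.

Lemma hamiltonian_or_sub_Bnk : ((k + 1) ^ 2 <= n)%N ->
  (n * (n - k) < \sum_(x in X) degree x)%N ->
  hamiltonian G \/ exists g : Bnk n k -> G,
    bijective g /\ forall u v, edge (g u) (g v) -> edge u v.
Proof.
move=> kn He; have kn2 : (2 * k + 2 <= n)%N by apply: leq_trans kn; nia.
have n1 : (1 < n)%N by lia.
have [hG|[e sat ee]] := hamiltonian_or_saturated n1; [by left|right].
have [eC bXe nh _] := sat.
have He' : (n * (n - k - 1) + (k + 1) ^ 2 < \sum_(v in X) deg e v)%N.
  have le : (\sum_(v in X) degree v <= \sum_(v in X) deg e v)%N.
    by apply: leq_sum => v _; exact: subrel_deg.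
  apply: leq_trans le; apply: leq_ltn_trans He.
  (* Splitting off n from n(n-k) reduces the comparison with the threshold to (k+1)^2 <= n. *)
  rewrite -[in leqRHS](@subnK 1 (n - k)) ?subn_gt0; last by lia.
  by rewrite mulnDr muln1 leq_add2l.
have dke v : (k <= deg e v)%N by apply: leq_trans (dk v) (subrel_deg _ ee).
have [S [T [[bST|bST] cS cT]]] := moon_moser sat cX cXC k0 kn2 dke He'.
  have [g [gb gE]] := block_complement_Bnk eC bXe cX cXC bST cS cT.
  by exists g; split=> // u v /ee; rewrite gE.
have cXCC : #|~: ~: X| = n by rewrite finset.setCK.
have [g [gb gE]] := block_complement_Bnk eC (bipartite_relC bXe) cXC cXCC bST cS cT.
by exists g; split=> // u v /ee; rewrite gE.
Qed.

(** Through [g], the weights of G become weights dominated by those of the connected B_n^k. One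
    statement serves the adjacency and the signless Laplacian weights. *)
Lemma Bnk_rigidity (w1 : G -> G -> R) (w2 : Bnk n k -> Bnk n k -> R) (g : Bnk n k -> G) :
  (k < n)%N -> bijective g ->
  (forall x y, w1 x y = w1 y x) -> (forall x y, w2 x y = w2 y x) ->
  (forall x y, 0 <= w1 x y) -> (forall u v, w1 (g u) (g v) <= w2 u v) ->
  (forall x y, edge x y -> 0 < w2 x y) ->
  max_eigenvalue w2 <= max_eigenvalue w1 -> forall u v, w1 (g u) (g v) = w2 u v.
Proof.
move=> kn gb C1 C2 w10 w12 we; have B0 := card_Bnk_gt0 kn.
rewrite -(max_eigenvalue_bij B0 gb C1) => le.
apply: (max_eigenvalue_rigidity B0 (w1 := fun u v => w1 (g u) (g v))) => // P Px Pw.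
by apply: (Bnk_irreducible k0 kn Px) => x y Px1 /we; exact: Pw Px1.
Qed.

Lemma adjw_inj (H K : sgraph) (a b : H) (c d : K) : adjw R a b = adjw R c d -> edge a b = edge c d.
Proof. by rewrite /adjw => /eqP; rewrite eqr_nat; case: edge; case: edge. Qed.

Lemma hamiltonian_or_Bnk_of_rho : ((k + 1) ^ 2 <= n)%N -> rho R (Bnk n k) <= rho R G ->
  hamiltonian G \/ isomorphic G (Bnk n k).
Proof.
move=> kn le_rho; have kn2 : (2 * k + 2 <= n)%N by apply: leq_trans kn; nia.
have kn1 : (k < n)%N by lia.
have B0 := card_Bnk_gt0 kn1.
have rB0 : 0 <= rho R (Bnk n k).
  have [_ /(_ (fun=> 1))] := max_eigenvalueP B0 (@adjw_sym R (Bnk n k)).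
  rewrite sumr_const expr1n -rhoE => h; have : 0 <= rho R (Bnk n k) * #|Bnk n k|%:R.
    apply: le_trans h; apply: sumr_ge0 => x _; apply: sumr_ge0 => y _.
    by rewrite !mulr1 adjw_ge0.
  by rewrite pmulr_lge0 // ltr0n.
have He : (n * (n - k) < \sum_(x in X) degree x)%N.
  rewrite -(ltr_nat R); apply: lt_le_trans (rho_Bnk_gt R k0 kn1) _.
  apply: le_trans (rho_sqr_le_edges R hX _); last by lia.
  by rewrite ler_sqr ?nnegrE // (le_trans rB0).
have [hG|[g [gb gE]]] := hamiltonian_or_sub_Bnk kn He; [by left|right].
apply: (isomorphic_of_inverse gb) => u v.
apply: adjw_inj; apply: (Bnk_rigidity (w1 := @adjw R G) (w2 := @adjw R (Bnk n k)) kn1 gb) => //.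
- exact: adjw_sym.
- exact: adjw_sym.
- by move=> x y; rewrite ler_nat; apply: leq_bool; exact: gE.
- by move=> x y xy; rewrite /adjw xy.
Qed.

Lemma hamiltonian_or_Bnk_of_q : ((k + 1) ^ 2 <= n)%N -> q R (Bnk n k) <= q R G ->
  hamiltonian G \/ isomorphic G (Bnk n k).
Proof.
move=> kn le_q; have kn2 : (2 * k + 2 <= n)%N by apply: leq_trans kn; nia.
have kn1 : (k < n)%N by lia.
have n0 : (0 < n)%N by lia.
have He : (n * (n - k) < \sum_(x in X) degree x)%N.
  have dpos x : (0 < @degree G x)%N by exact: leq_trans k0 (dk x).
  have := lt_le_trans (q_Bnk_gt R k0 kn1) (le_trans le_q (q_le_edges R hX n0 dpos)).
  rewrite natrD addrC ltrD2r ltr_pdivlMr ?ltr0n // -natrM ltr_nat.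
  by rewrite mulnC.
have [hG|[g [gb gE]]] := hamiltonian_or_sub_Bnk kn He; [by left|right].
have dg u : (degree (g u) <= degree u)%N.
  rewrite !degreeE (reindex g) /=; last exact: onW_bij.
  by apply: leq_sum => v _; apply: leq_bool; exact: gE.
apply: (isomorphic_of_inverse gb) => u v.
have [->|uv] := eqVneq u v; first by rewrite !edge_irr.
apply: adjw_inj; have : slw R (g u) (g v) = slw R u v.
  apply: (Bnk_rigidity (w1 := @slw R G) (w2 := @slw R (Bnk n k)) kn1 gb).
  - exact: slw_sym.
  - exact: slw_sym.
  - exact: slw_ge0.
  - move=> x y; rewrite /slw (inj_eq (bij_inj gb)) lerD //.
      by rewrite ler_nat; apply: leq_bool; exact: gE.
    by rewrite ler_wpM2l ?ler0n // ler_nat dg.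
  - by move=> x y xy; rewrite /slw /adjw xy ltr_pwDl // mulr_ge0 ?ler0n.
  - by rewrite -!qE.
by rewrite /slw (inj_eq (bij_inj gb)) (negbTE uv) !mul0r !addr0.
Qed.

(** * The condition on the quasi-complement *)

Section QuasiComplement.
Hypothesis kn : (2 * k <= n)%N.
Hypothesis le_rho : rho R (quasi_complement X) <= rho R (Bnk_qcompl n k).
Variable e : rel G.
Hypotheses (sat : ham_saturated X e) (ee : subrel (@edge G) e).

Let eC : symmetric e. Proof. by case: sat. Qed.
Let bXe : bipartite_rel X e. Proof. by case: sat. Qed.
Let n0 : (0 < n)%N. Proof. by apply: leq_trans kn; rewrite muln_gt0. Qed.
Let kn1 : (k < n)%N. Proof. by apply: leq_trans kn; rewrite mul2n -addnn -addn1 leq_add2l. Qed.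

(** The quasi-complement of the saturated graph [e], with degrees [codeg]. It is contained in that
    of G, whose adjacency is [w] below, because G lies inside [e]. *)
Let hat (u v : G) : bool := ((u \in X) != (v \in X)) && ~~ e u v.
Let codeg v := #|[set u | hat v u]|.

Let codegE v : codeg v = (n - deg e v)%N.
Proof. by rewrite -(card_nonnbrs v bXe cX cXC) addnK. Qed.

Let ke v : (k <= deg e v)%N. Proof. exact: leq_trans (dk v) (subrel_deg _ ee). Qed.

Let hat_deg_sum u v : hat u v -> (deg e u + deg e v <= n)%N.
Proof.
rewrite /hat; have [uX|uX] := boolP (u \in X); have [vX|vX] := boolP (v \in X) => //= nuv.
  exact: deg_sum_le sat cX cXC uX vX nuv.
by rewrite addnC; apply: (deg_sum_le sat cX cXC) => //; rewrite eC.
Qed.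

Let c : R := Num.sqrt (k * (n - k))%:R.
Let z v : R := Num.sqrt (codeg v)%:R.
Let w := adjw R (G := quasi_complement X).

Let rho_le_c : rho R (quasi_complement X) <= c.
Proof.
apply: le_trans le_rho _; apply: le_trans (ler_norm _) _; rewrite -sqrtr_sqr.
by apply: ler_wsqrtr; exact: rho_Bnk_qcompl_le.
Qed.

Let sqr_z v : z v ^+ 2 = (codeg v)%:R. Proof. by rewrite sqr_sqrtr. Qed.

Let form_le g : qform w g <= c * \sum_x g x ^+ 2.
Proof.
have G0 : (0 < #|quasi_complement X|)%N by rewrite [#|_|]cG double_gt0.
have [_ /(_ g) h] := max_eigenvalueP G0 (@adjw_sym R (quasi_complement X)).
apply: le_trans h _; rewrite ler_wpM2r ?rho_le_c //.
by apply: sumr_ge0 => x _; exact: sqr_ge0.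
Qed.

(** All terms add up to the form at [z] minus [c] times the square norm of [z], because the pairs in
    [hat] are counted by the sum of [codeg]. Each term is nonnegative and the spectral hypothesis
    makes the sum nonpositive, so all of them vanish. *)
Let term u v := w u v * z u * z v - c * (hat u v)%:R.

Let mul_z u v : z u * z v = Num.sqrt (codeg u * codeg v)%:R.
Proof. by rewrite /z -sqrtrM // natrM. Qed.

Let hat_w u v : hat u v -> w u v = 1.
Proof.
case/andP=> uv nuv; rewrite /w /adjw /= /qcompl_edge uv.
by rewrite (contraNN (@ee u v)).
Qed.

Let term_ge0 u v : 0 <= term u v.
Proof.
rewrite /term; have [huv|_] := boolP (hat u v); last first.
  by rewrite mulr0 subr0 !mulr_ge0 ?adjw_ge0 ?sqrtr_ge0.
rewrite hat_w // mul1r mulr1 subr_ge0 mul_z ler_wsqrtr // ler_nat !codegE.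
by apply: codegree_product => //; exact: hat_deg_sum.
Qed.

Let sum_term : \sum_u \sum_v term u v = qform w z - c * \sum_u z u ^+ 2.
Proof.
rewrite big_distrr -sumrB; apply: eq_bigr => u _.
rewrite sumrB -big_distrr /=; congr (_ - c * _); rewrite sqr_z.
by rewrite /codeg -sum1dep_card natr_sum [RHS]big_mkcond; apply: eq_bigr => v _; case: hat.
Qed.

Let form_ge : c * \sum_u z u ^+ 2 <= qform w z.
Proof. by rewrite -subr_ge0 -sum_term; apply: sumr_ge0 => u _; apply: sumr_ge0. Qed.

Let term0 u v : term u v = 0.
Proof.
have : \sum_u \sum_v term u v == 0.
  by rewrite eq_le sum_term subr_le0 form_le subr_ge0 form_ge.
rewrite psumr_eq0 => [/allP/(_ u (mem_index_enum _))/=|x _]; last exact: sumr_ge0.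
by rewrite psumr_eq0 // => /allP/(_ v (mem_index_enum _))/eqP.
Qed.

Let z_eigen x : wapply w z x = c * z x.
Proof. by apply: rayleigh_kernel => //; exact: adjw_sym. Qed.

Let hat_degrees u v : hat u v ->
  (deg e u + deg e v)%N = n /\ (deg e u = k \/ deg e u = n - k)%N.
Proof.
move=> huv; apply: codegree_product_eq => //; [by rewrite k0 ke|exact: hat_deg_sum|].
have /eqP := term0 u v; rewrite /term hat_w // huv mul1r mulr1 subr_eq0 mul_z => /eqP h.
by apply/eqP; rewrite -(@eqr_nat R) -!codegE -(sqr_sqrtr (ler0n _ _)) h sqr_sqrtr.
Qed.

Let codeg_gt0 u v : hat u v -> (0 < codeg u)%N.
Proof. by move=> huv; apply/card_gt0P; exists v; rewrite inE. Qed.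

(** For an edge of [e] missing in G, the term is [z u * z v], so [z v = 0]. But [z] is an
    eigenfunction, and its zero at [v] spreads to the neighbour [u] in the quasi-complement of G,
    against the positive codegree of [u]. *)
Let edge_kept u v : (0 < codeg u)%N -> (u \in X) != (v \in X) -> edge u v = e u v.
Proof.
move=> du uv; apply/idP/idP => [/ee //|euv]; apply/negPn/negP => nuv.
have zu : 0 < z u by rewrite sqrtr_gt0 ltr0n.
have w1 : w u v = 1 by rewrite /w /adjw /= /qcompl_edge uv nuv.
have zv : z v = 0.
  have := term0 u v; rewrite /term w1 /hat euv andbF mulr0 subr0 mul1r => /eqP.
  by rewrite mulf_eq0 gt_eqF //= => /eqP.
have := z_eigen v; rewrite zv mulr0 => /eqP; rewrite psumr_eq0 => [|y _]; last first.
  by rewrite mulr_ge0 ?adjw_ge0 ?sqrtr_ge0.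
move=> /allP/(_ u (mem_index_enum _))/=.
by rewrite [w v u]adjw_sym -/(w u v) w1 mul1r gt_eqF.
Qed.

Lemma qcompl_structure : calB n k G \/
  [/\ n = 4%N, k = 2%N & isomorphic G Gamma1 \/ isomorphic G Gamma2].
Proof.
have hatI x y : x \in X -> y \notin X -> ~~ e x y -> hat x y.
  by move=> xX yX nxy; rewrite /hat xX (negbTE yX).
have hatC x y : hat x y = hat y x by rewrite /hat eq_sym eC.
have dsum x y : x \in X -> y \notin X -> ~~ e x y -> (deg e x + deg e y)%N = n.
  by move=> xX yX nxy; have [] := hat_degrees (hatI _ _ xX yX nxy).
have kept x y : x \in X -> y \notin X -> (0 < codeg x)%N || (0 < codeg y)%N ->
    edge x y = e x y.
  move=> xX yX /orP[dx|dy]; first by apply: edge_kept; rewrite // xX (negbTE yX).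
  by rewrite edge_sym eC; apply: edge_kept; rewrite // xX (negbTE yX).
have [[S [T [[SX TX hS hT] cST cS cT]]]|[n4 [ts [bs lab]]]] :=
  degree_sum_structure sat cX cXC dsum n0.
  left; have /card_gt0P[x xS] := cS; have /card_gt0P[y yT] := cT.
  have xX := fintype.subsetP SX _ xS.
  have yX : y \notin X by have := fintype.subsetP TX _ yT; rewrite inE.
  have hxy x' y' : x' \in S -> y' \in T -> hat x' y'.
    move=> x'S y'T; have y'X := fintype.subsetP TX _ y'T; rewrite inE in y'X.
    by apply: hatI; rewrite ?hS ?y'T // (fintype.subsetP SX).
  have iso : isolated_block X (@edge G) S T.
    split=> // [u v uS vX|u v uX vT].
      have uX := fintype.subsetP SX _ uS.
      by rewrite kept // ?hS // (codeg_gt0 (hxy _ _ uS yT)).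
    have vX := fintype.subsetP TX _ vT; rewrite inE in vX.
    by rewrite kept // ?hT // orbC (codeg_gt0 (v := x)) // hatC hxy.
  have dx : deg e x = #|S|.
    rewrite (deg_bipartite bXe xX); have -> : #|S| = #|~: X :\: T|.
      by rewrite cardsD (finset.setIidPr TX) cXC -cST addnK.
    apply: eq_card => v; rewrite !inE andbC; have [vX|vX] := boolP (v \in X) => /=.
      by rewrite !andbF.
    by rewrite hS // !andbT.
  (* The size of [S] is the degree of [x], so [k] or [n - k]; in the first case the two sides are
     exchanged to fit [calB]. *)
  have [_ [dk'|dk']] := hat_degrees (hxy _ _ xS yT); rewrite dx in dk'.
    apply: (isolated_block_calB _ cXC _ (isolated_blockC (@edge_sym G) iso)).
    - exact: bipartite_relC.
    - by rewrite finset.setCK.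
    - exact: ltnW.
    - by rewrite -cST dk' addKn.
    - exact: dk'.
  apply: (isolated_block_calB bX cX cXC iso) => //; first exact: ltnW.
  by apply/eqP; rewrite -(eqn_add2l #|S|) cST dk' subnK // ltnW.
right; have [ti bi tX bX' eE] := lab.
have hij i j : i != j -> i != ord0 -> j != ord0 -> hat (ts i) (bs j).
  by move=> ij i0 j0; apply: hatI; rewrite ?tX ?bX' // eE negb_or ij negb_or i0.
pose i1 : 'I_4 := @Ordinal 4 1 isT; pose i2 : 'I_4 := @Ordinal 4 2 isT.
have ct i : i != ord0 -> (0 < codeg (ts i))%N.
  move=> i0; apply: (@codeg_gt0 _ (bs (if i == i1 then i2 else i1))); apply: hij => //.
    by have [->|] := eqVneq i i1.
  by case: ifP.
have cb i : i != ord0 -> (0 < codeg (bs i))%N.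
  move=> i0; apply: (@codeg_gt0 _ (ts (if i == i1 then i2 else i1))).
  rewrite hatC; apply: hij => //; last by case: ifP.
  by have [->|] := eqVneq i i1; rewrite // eq_sym.
split=> //.
  (* The non-adjacent vertices t_2 and b_3 have degree at least 2 and degree sum 4, so both degrees
     are 2; as a degree is k or 4 - k, this gives k = 2. *)
  have h12 : hat (ts i1) (bs i2) by exact: hij.
  have two (x y1 y2 : G) : y1 != y2 -> e x y1 -> e x y2 -> (2 <= deg e x)%N.
    move=> y12 xy1 xy2; have <- : #|[set y1; y2]| = 2%N by rewrite cards2 y12.
    by apply: subset_leq_card; apply/fintype.subsetP => v; rewrite !inE => /orP[]/eqP->.
  have d1 : (2 <= deg e (ts i1))%N.
    by apply: (two _ (bs ord0) (bs i1)); rewrite ?(inj_eq bi) ?eE.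
  have d2 : (2 <= deg e (bs i2))%N.
    by apply: (two _ (ts ord0) (ts i2)); rewrite ?(inj_eq ti) ?[e (bs _) _]eC ?eE.
  have := hat_degrees h12; move: d1 d2 kn k0; rewrite n4.
  by move: (deg e (ts i1)) (deg e (bs i2)) => a b; clear; lia.
have cX4 : #|X| = 4%N by rewrite cX n4.
have cXC4 : #|~: X| = 4%N by rewrite cXC n4.
(* Only the pair of hubs can have both codegrees 0; everywhere else G agrees with [e]. *)
apply: (gamma_isomorphic bX cX4 cXC4 lab) => i j ij; apply: kept => //.
by case/orP: ij => [/ct ->|/cb ->]; rewrite ?orbT.
Qed.

End QuasiComplement.
End Hamiltonicity.

Theorem theorem1p10 (R : realType) (n k : nat) (G : sgraph) (X : {set G})
    (hX : balanced_bipartition n X)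
    (hk : (1 <= k)%N) (hdeg : (k <= min_degree G)%N) :
  [/\ ((k + 1) ^ 2 <= n)%N -> rho R (Bnk n k) <= rho R G ->
        hamiltonian G \/ isomorphic G (Bnk n k),
      ((k + 1) ^ 2 <= n)%N -> q R (Bnk n k) <= q R G ->
        hamiltonian G \/ isomorphic G (Bnk n k)
    & (2 * k <= n)%N ->
      rho R (quasi_complement X) <= rho R (Bnk_qcompl n k) ->
        hamiltonian G \/ calB n k G \/
        [/\ n = 4%N, k = 2%N & isomorphic G Gamma1 \/ isomorphic G Gamma2]].
Proof.
have dk x := leq_trans hdeg (min_degree_le x).
split; [exact: (hamiltonian_or_Bnk_of_rho hX hk dk)|exact: (hamiltonian_or_Bnk_of_q hX hk dk)|].
move=> kn le_rho.
have n1 : (1 < n)%N by move: hk kn; clear; lia.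
have [hG|[e sat ee]] := hamiltonian_or_saturated hX n1; [by left|right].
exact: (qcompl_structure hX hk dk kn le_rho sat ee).
Qed.
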